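(* Let $\mu\in\mathcal M_0(M)\setminus\{0\}$ and let $\varphi,\psi\in T^{\mathsf{ana}}_\mu\mathcal M_0=H^1(\mu)$ be linearly independent, i.e. $\Lambda_\mu(\varphi,\psi)>0$, and such that $s\varphi$ and $t\psi$ are admissible for all sufficiently small $s,t>0$. Write $\Lambda=\Lambda_\mu(\varphi,\psi)$. (i) The sectional curvature decomposes as $$\mathsf{Sec}_\mu(\varphi,\psi)=\mathsf{Sec}^\uparrow_\mu(\varphi,\psi)+\mathsf{Sec}^\nabla_\mu(\varphi,\psi)$$ into its lifted part $$\mathsf{Sec}^\uparrow_\mu(\varphi,\psi)=\lim^{*}_{s,t\to0}\frac{3}{\Lambda s^2t^2}\Big[\|s\varphi-t\psi\|^2_{H^1(\mu)}-\int_C d_C^2\Big(\exp^C_{(x,r)}\big(s(\nabla\varphi,2r\varphi)\big),\exp^C_{(x,r)}\big(t(\nabla\psi,2r\psi)\big)\Big)\,d\hat\mu(x,r)\Big]$$ and its twisted part $$\mathsf{Sec}^\nabla_\mu(\varphi,\psi)=\lim^{*}_{s,t\to0}\frac{3}{\Lambda s^2t^2}\Big[\int_C d_C^2\Big(\exp^C_{(x,r)}\big(s(\nabla\varphi,2r\varphi)\big),\exp^C_{(x,r)}\big(t(\nabla\psi,2r\psi)\big)\Big)\,d\hat\mu(x,r)-\mathsf{HK}^2\big(\exp_\mu(s\varphi),\exp_\mu(t\psi)\big)\Big],$$ provided these limits exist. (ii) The twisted part is always nonnegative: $\mathsf{Sec}^\nabla_\mu(\varphi,\psi)\ge0$. (iii)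 For all $a,b>0$: $\mathsf{Sec}_\mu(a\varphi,b\psi)=\mathsf{Sec}_\mu(\varphi,\psi)$. (iv) For every $a>0$: $\mathsf{Sec}_{a\mu}(\varphi,\psi)=\frac1a\mathsf{Sec}_\mu(\varphi,\psi)$, and similarly $\mathsf{Sec}^\uparrow_{a\mu}(\varphi,\psi)=\frac1a\mathsf{Sec}^\uparrow_\mu(\varphi,\psi)$ and $\mathsf{Sec}^\nabla_{a\mu}(\varphi,\psi)=\frac1a\mathsf{Sec}^\nabla_\mu(\varphi,\psi)$. (In (ii)-(iv) the quantities are considered whenever the defining limits exist.)
   Context: $(M,g)$ is a smooth Riemannian manifold without boundary, not necessarily complete, with uniformly bounded sectional curvature and Riemannian distance $d$. $\mathcal M_0(M)$ is the set of finite Borel measures on $M$. Cone: $C=(M\times[0,\infty))/\!\sim$, where $(x,r)\sim(x',r')$ iff they are equal or $r=r'=0$ (the vertex $o$), with metric $d_C((x,r),(x',r'))^2=r^2+r'^2-2rr'\cos(\min(d(x,x'),\pi))$. $\mathcal M_2(C)$ (resp. $\mathcal M_2(C\times C)$) is the set of Borel measures integrating $1+$ squared distance to a fixed point. For $\nu\in\mathcal M_2(C)$ let $\Pr(\nu)(A)=\int_{A\times[0,\infty)}r^2\,d\nu(x,r)$, a finite measure on $M$. With $\pi_0,\pi_1:C\times C\to C$ the coordinate projections, the Hellinger-Kantorovich metric is $$\mathsf{HK}(\mu_0,\mu_1)=\inf\Big\{\int_{C\times C} d_C^2\,dq:\ q\in\mathcal M_2(C\times C),\ \Pr((\pi_0)_*q)=\mu_0,\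 \Pr((\pi_1)_*q)=\mu_1\Big\}^{1/2}.$$ For $(x,r)$ with $r>0$, the tangent space of $C$ is $T_xM\times\mathbb R$ with $|(v,s)|^2_{(x,r)}=r^2|v|_x^2+s^2$, and for $s>-r$, $|v|<(1+s/r)\pi/2$, $$\exp^C_{(x,r)}(v,s)=\Big(\exp^M_x\Big(\arctan\Big(\tfrac{r|v|}{r+s}\Big)\tfrac{v}{|v|}\Big),\sqrt{(r+s)^2+r^2|v|^2}\Big)$$ (first component $x$ if $v=0$). For $\mu\ne0$ put $r_\mu=\sqrt{\mu(M)}$ and $\hat\mu=\frac1{r_\mu^2}\,\mu\otimes\delta_{r_\mu}$, a probability measure on $C$. A function $\varphi$ is admissible if $|\nabla\varphi|<\frac\pi2(1+2\varphi)$ (so that $\exp^C$ of the vector field $(x,r)\mapsto(\nabla\varphi(x),2r\varphi(x))$ is defined), and then $\exp_\mu(\varphi)=\Pr\big(\exp^C((\nabla\varphi,2r\varphi))_*\hat\mu\big)\in\mathcal M_0(M)$. $T^{\mathsf{ana}}_\mu\mathcal M_0=H^1(\mu)$ is the closure of $C_c^\infty(M)$ with respect to $\|\varphi\|^2_{H^1(\mu)}=\int_M(|\nabla\varphi|^2+4\varphi^2)\,d\mu$, with corresponding inner product $\langle\varphi,\psi\rangle_{H^1(\mu)}=\int_M(\langle\nabla\varphi,\nabla\psi\rangle+4\varphi\psi)\,d\mu$, and $\Lambda_\mu(\varphi,\psi)=\|\varphi\|^2_{H^1(\mu)}\|\psi\|^2_{H^1(\mu)}-\langle\varphi,\psi\rangle^2_{H^1(\mu)}$.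 $\lim^{*}_{s,t\to0}F(s,t)=L$ means $F(s_j,t_j)\to L$ for every sequence in $(0,\infty)^2$ with $s_j,t_j\to0$ and $\sup_j(s_j/t_j+t_j/s_j)<\infty$. Sectional curvature: $$\mathsf{Sec}_\mu(\varphi,\psi)=\lim^{*}_{s,t\to0}\frac{3}{\Lambda_\mu(\varphi,\psi)s^2t^2}\Big[\|s\varphi-t\psi\|_{H^1(\mu)}^2-\mathsf{HK}^2\big(\exp_\mu(s\varphi),\exp_\mu(t\psi)\big)\Big],$$ provided the limit exists. *)

(* Defs.v *)
From HB Require Import structures.
From mathcomp Require Import all_boot all_order all_algebra.
From mathcomp Require Import all_classical all_reals all_analysis.
Set Implicit Arguments.
Unset Strict Implicit.
Unset Printing Implicit Defensive.
Import Order.TTheory GRing.Theory Num.Theory.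
Import numFieldNormedType.Exports.
Local Open Scope classical_set_scope.
Local Open Scope ring_scope.

(** * Smooth functions on open subsets of R^n (row vectors) *)

Section smooth.
Variables (R : realType) (n : nat).
Implicit Types (U : set 'rV[R]_n).

Definition basis_vec (j : 'I_n) : 'rV[R]_n := delta_mx 0 j.

Definition partial (j : 'I_n) (f : 'rV[R]_n -> R) (u : 'rV[R]_n) : R :=
  'D_(basis_vec j) f u.

Fixpoint Ck_on (k : nat) U (f : 'rV[R]_n -> R) : Prop :=
  (forall u, U u -> {for u, continuous f}) /\
  if k is k'.+1 then
    forall j, (forall u, U u -> derivable f u (basis_vec j)) /\
              Ck_on k' U (partial j f)
  else True.

Definition smooth_on U (f : 'rV[R]_n -> R) := forall k, Ck_on k U f.

(* Row convention: a tangent vector v is mapped to v *m jac f u. *)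
Definition jac (f : 'rV[R]_n -> 'rV[R]_n) (u : 'rV[R]_n) : 'M[R]_n :=
  \matrix_(i, j) partial i (fun w => f w 0 j) u.

End smooth.

(** * Riemannian manifolds *)

Record chart (R : realType) (n : nat) (M : topologicalType) := Chart {
  cdom : set M;
  cmap : M -> 'rV[R]_n;
  cinv : 'rV[R]_n -> M;
  cdom_open : open cdom;
  cimg_open : open (cmap @` cdom);
  cmapK : forall x, cdom x -> cinv (cmap x) = x;
  cmap_continuous : forall x, cdom x -> {for x, continuous cmap};
  cinv_continuous : forall u, (cmap @` cdom) u -> {for u, continuous cinv}
}.

Definition transition (R : realType) n (M : topologicalType)
  (c c' : chart R n M) (u : 'rV[R]_n) : 'rV[R]_n := cmap c' (cinv c u).

(* The points are pointed only because measurable types are. The point of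
   [chart_at] is that the tangent space at x is modelled on R^n through the
   chart [chart_at x]. *)
Record smooth_manifold (R : realType) (n : nat) := SmoothManifold {
  carrier :> ptopologicalType;
  carrier_hausdorff : hausdorff_space carrier;
  carrier_second_countable : @second_countable carrier;
  atlas : set (chart R n carrier);
  chart_at : carrier -> chart R n carrier;
  chart_at_atlas : forall x, atlas (chart_at x);
  chart_at_dom : forall x, cdom (chart_at x) x;
  transition_smooth : forall c c', atlas c -> atlas c' -> forall j,
    smooth_on (cmap c @` (cdom c `&` cdom c')) (fun u => transition c c' u 0 j)
}.

(* [metric c u] is the matrix of g at the point of coordinates u in chart c. *)
Record riemannian_manifold (R : realType) (n : nat) := RiemannianManifold {
  underlying :> smooth_manifold R n;
  metric : chart R n underlying -> 'rV[R]_n -> 'M[R]_n;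
  metric_smooth : forall c, atlas c -> forall i j,
    smooth_on (cmap c @` cdom c) (fun u => metric c u i j);
  metric_sym : forall c u, atlas c -> (cmap c @` cdom c) u ->
    (metric c u)^T = metric c u;
  metric_posdef : forall c u (v : 'rV[R]_n), atlas c ->
    (cmap c @` cdom c) u -> v != 0 -> 0 < (v *m metric c u *m v^T) 0 0;
  metric_compat : forall c c' u, atlas c -> atlas c' ->
    (cmap c @` (cdom c `&` cdom c')) u ->
    metric c u = jac (transition c c') u
                 *m metric c' (transition c c' u)
                 *m (jac (transition c c') u)^T
}.

Section riemannian.
Variables (R : realType) (n : nat) (M : riemannian_manifold R n).
Implicit Types (x y : M) (v w : 'rV[R]_n) (c : chart R n M).

(* coordinates in the chart c of a tangent vector v at x *)
Definition tcoord c x v : 'rV[R]_n :=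
  v *m jac (transition (chart_at x) c) (cmap (chart_at x) x).

Definition metric_at x : 'M[R]_n :=
  metric (chart_at x) (cmap (chart_at x) x).

Definition tinner x v w : R := (v *m metric_at x *m w^T) 0 0.

Definition tnorm x v : R := Num.sqrt (tinner x v v).

Definition smooth_fun (f : M -> R) :=
  forall c, atlas c -> smooth_on (cmap c @` cdom c) (f \o cinv c).

Definition Cc_infty (f : M -> R) :=
  smooth_fun f /\ compact (closure [set x | f x != 0]).

Definition grad (f : M -> R) x : 'rV[R]_n :=
  (\row_j partial j (f \o cinv (chart_at x)) (cmap (chart_at x) x))
  *m invmx (metric_at x).

(* Gamma^k_ij in the chart c *)
Definition christoffel c (k i j : 'I_n) (u : 'rV[R]_n) : R :=
  2^-1 * \sum_l invmx (metric c u) k l *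
    (partial i (fun w => metric c w l j) u
     + partial j (fun w => metric c w i l) u
     - partial l (fun w => metric c w i j) u).

(* R(e_i, e_j) e_k = \sum_l (curvature c l k i j) e_l *)
Definition curvature c (l k i j : 'I_n) (u : 'rV[R]_n) : R :=
  partial i (christoffel c l j k) u - partial j (christoffel c l i k) u
  + \sum_m (christoffel c l i m u * christoffel c m j k u
            - christoffel c l j m u * christoffel c m i k u).

(* <R(v,w)w, v> / (|v|^2 |w|^2 - <v,w>^2) *)
Definition sectional c (u v w : 'rV[R]_n) : R :=
  let ip (a b : 'rV[R]_n) := (a *m metric c u *m b^T) 0 0 in
  let Rvww : 'rV[R]_n := \row_l \sum_i \sum_j \sum_k
    curvature c l k i j u * v 0 i * w 0 j * w 0 k in
  ip Rvww v / (ip v v * ip w w - ip v w ^+ 2).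

Definition bounded_sectional_curvature :=
  exists K : R, forall c u v w, atlas c -> (cmap c @` cdom c) u ->
    row_free (col_mx v w) -> `|sectional c u v w| <= K.

Definition curve_coord c (g : R -> M) (j : 'I_n) (t : R) : R :=
  cmap c (g t) 0 j.

Definition velocity (g : R -> M) (t : R) : 'rV[R]_n :=
  \row_j derive1 (curve_coord (chart_at (g t)) g j) t.

(* C^1 on a neighbourhood of [0,1] *)
Definition C1_curve (g : R -> M) :=
  exists2 e : R, 0 < e & forall t, - e < t < 1 + e ->
    {for t, continuous g} /\
    forall c j, atlas c -> cdom c (g t) ->
      derivable (curve_coord c g j) t 1 /\
      {for t, continuous (derive1 (curve_coord c g j))}.

Definition curve_length (g : R -> M) : R :=
  \int[@lebesgue_measure R]_(t in `[0, 1]) tnorm (g t) (velocity g t).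

(* [joined x y l]: there is a piecewise C^1 curve of length l from x to y;
   each C^1 piece is parametrized by [0,1]. *)
Inductive joined : M -> M -> R -> Prop :=
| joined_nil x : joined x x 0
| joined_cons (g : R -> M) y l : C1_curve g -> joined (g 1) y l ->
    joined (g 0) y (curve_length g + l).

(* +oo if x and y are in different components *)
Definition rdist x y : \bar R := ereal_inf [set l%:E | l in joined x y].

Definition geodesic (g : R -> M) :=
  exists2 e : R, 0 < e & forall t, - e < t < 1 + e ->
    {for t, continuous g} /\
    forall c k, atlas c -> cdom c (g t) ->
      [/\ derivable (curve_coord c g k) t 1,
          derivable (derive1 (curve_coord c g k)) t 1 &
          derive1 (derive1 (curve_coord c g k)) t =
            - \sum_i \sum_j christoffel c k i j (cmap c (g t))
                * derive1 (curve_coord c g i) t * derive1 (curve_coord c g j) t].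

Definition geodesic_endpoint x v : set M :=
  [set y | exists g, [/\ geodesic g, g 0 = x, velocity g 0 = v & g 1 = y]].

(* M need not be complete: exp^M is only meaningful on [expM_dom]. *)
Definition expM_dom x v := geodesic_endpoint x v !=set0.
Definition expM x v : M := xget x (geodesic_endpoint x v).

End riemannian.

(** * The cone *)

(* The vertex is None, and the class of (x, r) with r > 0 is Some (x, r). *)
Definition cone (R : realType) (n : nat) (M : riemannian_manifold R n) : Type :=
  option (M * {posnum R}).

HB.instance Definition _ R n (M : riemannian_manifold R n) :=
  Pointed.copy (cone M) (option (M * {posnum R})).

Section cone.
Variables (R : realType) (n : nat) (M : riemannian_manifold R n).
Implicit Types (p q : cone M) (x : M) (r : R).

(* the class of (x, r), for r >= 0 *)
Definition cone_pt x r : cone M :=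
  if @idP (0 < r) is ReflectT r0 then Some (x, PosNum r0) else None.

Definition radius p : R := if p is Some (_, r) then r%:num else 0.

(* the value at the vertex is irrelevant in [dC] *)
Definition angle p q : R :=
  match p, q with
  | Some (x, _), Some (y, _) => fine (mine (rdist x y) pi%:E)
  | _, _ => 0
  end.

Definition dC p q : R :=
  Num.sqrt (radius p ^+ 2 + radius q ^+ 2
            - 2 * radius p * radius q * cos (angle p q)).

Definition dC_open : set (set (cone M)) :=
  [set U | forall p, U p ->
     exists2 e : R, 0 < e & forall q, dC p q < e -> U q].

Definition dC2_open : set (set (cone M * cone M)%type) :=
  [set U | forall z, U z -> exists2 e : R, 0 < e &
     forall w, dC z.1 w.1 < e -> dC z.2 w.2 < e -> U w].

End cone.

(* Borel sigma-algebras of M, C and C * C *)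
Notation borelM M := (g_sigma_algebraType (@open M)).
Notation borelC M := (g_sigma_algebraType (@dC_open _ _ M)).
Notation borelCC M := (g_sigma_algebraType (@dC2_open _ _ M)).

Section hellinger_kantorovich.
Variables (R : realType) (n : nat) (M : riemannian_manifold R n).

(* A * [0, +oo[ in the cone *)
Definition cylinder (A : set M) : set (cone M) :=
  [set cone_pt z.1 z.2 | z in A `*` [set r : R | 0 <= r]].

Definition Pr (nu : set (borelC M) -> \bar R) (A : set M) : \bar R :=
  (\int[nu]_(p in cylinder A) (radius p ^+ 2)%:E)%E.

(* the fixed point is (o, o) *)
Definition in_M2CC (q : {measure set (borelCC M) -> \bar R}) :=
  (\int[q]_z (1 + dC z.1 (None : cone M) ^+ 2
                + dC z.2 (None : cone M) ^+ 2)%:E < +oo)%E.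

Definition HK_plan (mu0 mu1 : set M -> \bar R)
    (q : {measure set (borelCC M) -> \bar R}) :=
  [/\ in_M2CC q,
      forall A : set (borelM M), measurable A ->
        Pr (pushforward q (fst : borelCC M -> borelC M)) A = mu0 A &
      forall A : set (borelM M), measurable A ->
        Pr (pushforward q (snd : borelCC M -> borelC M)) A = mu1 A].

Definition HK (mu0 mu1 : set M -> \bar R) : R :=
  Num.sqrt (fine (ereal_inf
    [set (\int[q]_z (dC z.1 z.2 ^+ 2)%:E)%E | q in HK_plan mu0 mu1])).

End hellinger_kantorovich.

(** * Exponential map of the cone and curvature *)

Section curvature.
Variables (R : realType) (n : nat) (M : riemannian_manifold R n).
Implicit Types (mu : {measure set (borelM M) -> \bar R}) (x : M).

(* displacement of the base point, in T_xM, if v != 0 *)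
Definition base_shift x (r : R) (v : 'rV[R]_n) (s : R) : 'rV[R]_n :=
  (atan (r * tnorm x v / (r + s)) / tnorm x v) *: v.

Definition expC_dom (p : cone M) (V : 'rV[R]_n * R) : Prop :=
  if p is Some (x, r) then
    [/\ - r%:num < V.2,
        tnorm x V.1 < (1 + V.2 / r%:num) * (pi / 2) &
        V.1 = 0 \/ expM_dom x (base_shift x r%:num V.1 V.2)]
  else False.

(* only meaningful on [expC_dom] *)
Definition expC (p : cone M) (V : 'rV[R]_n * R) : cone M :=
  if p is Some (x, r) then
    cone_pt (if V.1 == 0 then x
             else expM x (base_shift x r%:num V.1 V.2))
            (Num.sqrt ((r%:num + V.2) ^+ 2 + r%:num ^+ 2 * tnorm x V.1 ^+ 2))
  else None.

(* For a general mu an element phi of H^1(mu) does not determine its gradient: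
   it is a limit of pairs (eta, grad eta), i.e. a pair (function, vector
   field). The field at x is written in the chart [chart_at x]. *)
Definition h1pair : Type := ((M -> R) * (M -> 'rV[R]_n))%type.

Definition h1val (phi : h1pair) : M -> R := phi.1.
Definition h1grad (phi : h1pair) : M -> 'rV[R]_n := phi.2.

Definition h1scale (a : R) (phi : h1pair) : h1pair :=
  (fun x => a * h1val phi x, fun x => a *: h1grad phi x).

Definition h1sub (phi psi : h1pair) : h1pair :=
  (fun x => h1val phi x - h1val psi x, fun x => h1grad phi x - h1grad psi x).

Definition smooth_pair (f : M -> R) : h1pair := (f, @grad R n M f).

Definition h1density (phi psi : h1pair) x : R :=
  tinner x (h1grad phi x) (h1grad psi x) + 4 * h1val phi x * h1val psi x.

Definition in_H1 mu (phi : h1pair) :=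
  [/\ measurable_fun [set: borelM M] (h1val phi),
      forall c j, atlas c -> measurable_fun (cdom c : set (borelM M))
        (fun x => tcoord c x (h1grad phi x) 0 j) &
      exists2 eta : nat -> M -> R, (forall k, Cc_infty (eta k)) &
        (fun k => \int[mu]_x
           (let d := h1sub phi (smooth_pair (eta k)) in h1density d d x)%:E)%E
          @ \oo --> 0%E].

Definition h1inner mu (phi psi : h1pair) : R :=
  \int[mu]_x h1density phi psi x.

Definition h1norm mu (phi : h1pair) : R := Num.sqrt (h1inner mu phi phi).

Definition Lambda mu (phi psi : h1pair) : R :=
  h1norm mu phi ^+ 2 * h1norm mu psi ^+ 2 - h1inner mu phi psi ^+ 2.

Definition r_of mu : R := Num.sqrt (fine (mu setT)).

(* r^-2 (mu \x \d_r) for r = r_of mu, transported to the cone *)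
Definition hat mu (B : set (borelC M)) : \bar R :=
  (((r_of mu ^+ 2)^-1)%:E * mu [set x | B (cone_pt x (r_of mu))])%E.

Definition cone_field (phi : h1pair) (p : cone M) : 'rV[R]_n * R :=
  if p is Some (x, r) then (h1grad phi x, 2 * r%:num * h1val phi x)
  else (0, 0).

(* The second condition matters for incomplete M, where the bound on the
   gradient does not ensure that exp^M is defined. *)
Definition admissible mu (phi : h1pair) :=
  {ae mu, forall x, tnorm x (h1grad phi x) < pi / 2 * (1 + 2 * h1val phi x)} /\
  {ae hat mu, forall p, expC_dom p (cone_field phi p)}.

(* exp^C of the field of phi, which is only defined (hat mu)-almost everywhere,
   as a Borel map of the cone; for phi admissible it exists and is unique up
   to a null set, so that the choice is irrelevant. *)
Definition exp_field mu (phi : h1pair) : borelC M -> borelC M :=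
  xget (fun=> None)
    [set T : borelC M -> borelC M | measurable_fun setT T /\
       {ae hat mu, forall p, T p = expC p (cone_field phi p)}].

Definition exp_mu mu (phi : h1pair) : set M -> \bar R :=
  Pr (pushforward (hat mu) (exp_field mu phi)).

(* \int dC^2 (exp^C (grad phi, 2 r phi), exp^C (grad psi, 2 r psi)) d(hat mu) *)
Definition lifted_cost mu (phi psi : h1pair) : R :=
  fine (\int[hat mu]_p (dC (exp_field mu phi p) (exp_field mu psi p) ^+ 2)%:E)%E.

Definition is_limstar (F : R -> R -> R) (L : R) :=
  forall s t : nat -> R,
    (forall j, 0 < s j) -> (forall j, 0 < t j) ->
    s @ \oo --> (0 : R) -> t @ \oo --> (0 : R) ->
    (exists K, forall j, s j / t j + t j / s j <= K) ->
    (fun j => F (s j) (t j)) @ \oo --> L.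

(* [is_Sec mu phi psi L]: the limit exists and is equal to L; likewise for
   the lifted and the twisted parts. *)
Definition is_Sec mu (phi psi : h1pair) (L : R) :=
  is_limstar (fun s t => 3 / (Lambda mu phi psi * s ^+ 2 * t ^+ 2) *
    (h1norm mu (h1sub (h1scale s phi) (h1scale t psi)) ^+ 2
     - HK (exp_mu mu (h1scale s phi)) (exp_mu mu (h1scale t psi)) ^+ 2)) L.

Definition is_Sec_lift mu (phi psi : h1pair) (L : R) :=
  is_limstar (fun s t => 3 / (Lambda mu phi psi * s ^+ 2 * t ^+ 2) *
    (h1norm mu (h1sub (h1scale s phi) (h1scale t psi)) ^+ 2
     - lifted_cost mu (h1scale s phi) (h1scale t psi))) L.

Definition is_Sec_twist mu (phi psi : h1pair) (L : R) :=
  is_limstar (fun s t => 3 / (Lambda mu phi psi * s ^+ 2 * t ^+ 2) *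
    (lifted_cost mu (h1scale s phi) (h1scale t psi)
     - HK (exp_mu mu (h1scale s phi)) (exp_mu mu (h1scale t psi)) ^+ 2)) L.

End curvature.

(* Main.v *)
(* Sec is the sum of its two parts before passing to the limit, and the scaling
   in phi and psi is a change of the variables s and t.

   The twisted part is nonnegative because the law under mu-hat of the pair
   (exp^C (s phi), exp^C (t psi)) is a competitor in the definition of HK. This
   requires that the pair be a Borel map to C * C, which follows from the
   separability of the cone and the triangle inequality for d_C, and that the
   competitor have finite second moments, which follows from phi being close in
   H^1(mu) to a smooth function with compact support.

   For the scaling in mu, the measure hat of a mu is the image of mu-hat by the
   dilation (x, r) |-> (x, sqrt a r), which commutes with exp^C and multiplies
   d_C^2 and r^2 by a; hence all the terms in the brackets are multiplied by a,
   whereas Lambda is multiplied by a^2. *)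

(* The tangent space at x is read in [chart_at x], which may jump with x, so velocities and
   gradients are moved to one fixed chart before continuity can be used; the chain rule serves this
   purpose. It gives two local bounds. Lengths of coordinate segments bound the distance near a
   point, so that x |-> (x, r) is continuous from M to the cone: this is how second countability of
   M becomes separability of the cone. The density |grad eta|^2 + 4 eta^2 is bounded near each
   point, hence everywhere if eta has compact support. Finite moments have a second use: [fine]
   sends +oo to 0, so an inequality between an infimum and an integral passes to the reals once both
   are known to be finite. In the scalings infinite values are harmless, because a positive factor
   fixes them; there the obstacle is that [exp_field] is a choice with the vertex as default, and
   the choices for mu and a mu are compared through uniqueness almost everywhere, or through both
   being the default. *)
Require Import Defs.
From HB Require Import structures.
From mathcomp Require Import all_boot all_order all_algebra.
From mathcomp Require Import all_classical all_reals all_analysis.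
From mathcomp Require Import measurable_realfun.
From mathcomp Require Import ring lra.
Import Order.TTheory GRing.Theory Num.Theory.
Import numFieldNormedType.Exports.
Local Open Scope classical_set_scope.
Local Open Scope ring_scope.
Set Implicit Arguments.
Unset Strict Implicit.
Unset Printing Implicit Defensive.

(* MathComp-Analysis also has a [radius], of a ball. *)
Local Notation radius := Defs.radius.

(** * Integrals of nonnegative, possibly nonmeasurable functions *)

(* The integral of a nonnegative function is a supremum over simple functions,
   hence a lower integral; the lemmas below use no measurability, which is not
   available for the integrands [dC _ _ ^+ 2] and [h1density]. *)
Section lower_integral.
Local Open Scope ereal_scope.
Context d (T : measurableType d) (R : realType).
Implicit Types (mu : {measure set T -> \bar R}) (f g : T -> \bar R).

Import HBNNSimple.

Lemma ge0_integral_le_bound mu f (B : \bar R) : (forall x, 0 <= f x) ->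
  (forall h : {nnsfun T >-> R}, (forall x, (h x)%:E <= f x) ->
     \int[mu]_x (h x)%:E <= B) ->
  \int[mu]_x f x <= B.
Proof.
move=> f0 hB; rewrite ge0_integralTE//.
by apply: ge_ereal_sup => _ [h hf <-]; rewrite -integralT_nnsfun; exact: hB.
Qed.

Lemma nnsfun_le_integral mu f (h : {nnsfun T >-> R}) :
  (forall x, (h x)%:E <= f x) -> \int[mu]_x (h x)%:E <= \int[mu]_x f x.
Proof.
move=> hf; rewrite integralT_nnsfun [leRHS]ge0_integralTE; last first.
  by move=> x; apply: le_trans (hf x); rewrite lee_fin.
by apply: ereal_sup_ubound; exists h.
Qed.

(** A simple function below f is multiplied by the indicator of the complement of the exceptional
    null set: its integral is the same and it is now below g everywhere. *)
Lemma ae_le_lower_integral mu f g :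
  (forall x, 0 <= f x) -> (forall x, 0 <= g x) ->
  {ae mu, forall x, f x <= g x} -> \int[mu]_x f x <= \int[mu]_x g x.
Proof.
move=> f0 g0 [A [mA muA fgA]]; apply: ge0_integral_le_bound => // h hf.
pose h' := proj_nnsfun h (measurableC mA).
have mh (k : {nnsfun T >-> R}) : measurable_fun setT ((EFin \o k) : T -> \bar R).
  by apply/measurable_EFinP; exact: measurable_funP.
rewrite (_ : \int[mu]_x (h x)%:E = \int[mu]_x (h' x)%:E).
  apply: nnsfun_le_integral => x; rewrite /h'/= /mindic indicE.
  have [xA|xA] := boolP (x \in ~` A); last by rewrite mulr0 g0.
  rewrite mulr1; apply: le_trans (hf x) _.
  by apply: contrapT => nfg; move: xA; rewrite inE; apply; exact: fgA.
apply: ae_eq_integral => //; [exact: mh|exact: mh|].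
apply: (@filterS _ (almost_everywhere mu) _ (~` A)) => [x Ax _|]; last first.
  by exists A; split; rewrite ?setCK.
by rewrite /h'/= /mindic indicE mem_set// mulr1.
Qed.

Lemma le_lower_integral mu f g : (forall x, 0 <= f x) ->
  (forall x, f x <= g x) -> \int[mu]_x f x <= \int[mu]_x g x.
Proof.
move=> f0 fg; apply: ae_le_lower_integral => //; last exact: aeW.
by move=> x; exact: le_trans (fg x).
Qed.

Lemma ae_eq_lower_integral mu f g :
  (forall x, 0 <= f x) -> (forall x, 0 <= g x) ->
  {ae mu, forall x, f x = g x} -> \int[mu]_x f x = \int[mu]_x g x.
Proof.
move=> f0 g0 fg; apply/eqP; rewrite eq_le; apply/andP; split;
  apply: ae_le_lower_integral => //; apply: filterS fg => x -> //.
Qed.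

Lemma lower_integralZl mu f (c : R) : (0 < c)%R -> (forall x, 0 <= f x) ->
  \int[mu]_x (c%:E * f x) = c%:E * \int[mu]_x f x.
Proof.
(* One inequality for every positive factor is enough: the converse is the same one for c^-1. *)
have le (b : R) (g : T -> \bar R) : (0 < b)%R -> (forall x, 0 <= g x) ->
    \int[mu]_x (b%:E * g x) <= b%:E * \int[mu]_x g x.
  move=> b0 g0; have b0' : 0 <= b%:E by rewrite lee_fin ltW.
  apply: ge0_integral_le_bound => [x|h hg]; first exact: mule_ge0.
  have bi0 : (0 <= b^-1)%R by rewrite invr_ge0 ltW.
  rewrite -lee_pdivrMl//.
  have mh : measurable_fun setT (EFin \o h).
    by apply/measurable_EFinP; exact: measurable_funP.
  rewrite -(@ge0_integralZl_EFin _ _ _ mu _ measurableT _ _ mh)//.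
    apply: (@nnsfun_le_integral mu g (scale_nnsfun h bi0)) => x /=.
    by rewrite EFinM lee_pdivrMl.
  by move=> x _ /=; rewrite lee_fin.
move=> c0 f0; apply/eqP; rewrite eq_le le//=.
rewrite -lee_pdivlMl//.
apply: le_trans (le _ (fun x => c%:E * f x) _ _) => //; last 2 first.
- by rewrite invr_gt0.
- by move=> x; rewrite mule_ge0// lee_fin ltW.
by under [leRHS]eq_integral do rewrite muleA -EFinM mulVf ?gt_eqF// mul1e.
Qed.

Lemma lower_integral_mscale mu f (k : {nonneg R}) :
  (0 < k%:num)%R -> (forall x, 0 <= f x) ->
  \int[mscale k mu]_x f x = k%:num%:E * \int[mu]_x f x.
Proof.
move=> k0 f0; have hk (h : {nnsfun T >-> R}) :
    \int[mscale k mu]_x (h x)%:E = k%:num%:E * \int[mu]_x (h x)%:E.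
  rewrite ge0_integral_mscale//; last by move=> x _; rewrite lee_fin.
  by apply/measurable_EFinP; exact: measurable_funP.
apply/eqP; rewrite eq_le; apply/andP; split.
  apply: ge0_integral_le_bound => // h hf; rewrite hk.
  by rewrite lee_pmul2l// ?nnsfun_le_integral// lte_fin.
rewrite -lee_pdivlMl//; apply: ge0_integral_le_bound => // h hf.
by rewrite lee_pdivlMl// -hk; exact: nnsfun_le_integral.
Qed.

End lower_integral.

Section lower_integral_pushforward.
Context d d' (T1 : measurableType d) (T2 : measurableType d') (R : realType).
Import HBNNSimple.

(** Simple functions below f pull back to simple functions below f \o F, but one below f \o F need
    not factor through F; for a nonmeasurable f this leaves only an inequality. *)
Lemma lower_integral_pushforward (mu : {measure set T1 -> \bar R})
    (F : T1 -> T2) (mF : measurable_fun setT F) (f : T2 -> \bar R) :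
  (forall x, 0 <= f x)%E ->
  (\int[pushforward mu F]_y f y <= \int[mu]_x f (F x))%E.
Proof.
move=> f0; apply: (@ge0_integral_le_bound _ _ _ (pushforward mu F)) => // h hf.
have mh : measurable_fun setT (EFin \o h).
  by apply/measurable_EFinP; exact: measurable_funP.
rewrite (@ge0_integral_pushforward _ _ _ _ _ _ mF mu _ _ measurableT mh)//; last first.
  by move=> x _ /=; rewrite lee_fin.
rewrite preimage_setT; apply: le_lower_integral => x /=; last exact: hf.
by rewrite lee_fin.
Qed.

End lower_integral_pushforward.

(** Valid at the infinities as well: a positive c fixes them and [fine] sends them to 0. *)
Lemma fine_pmulEl (R : realType) (c : R) (x : \bar R) : 0 < c ->
  fine (c%:E * x)%E = c * fine x.
Proof.
by case: x => [x| |] c0 //=; rewrite ?gt0_muley ?gt0_muleNy ?lte_fin//= mulr0.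
Qed.

(** No integrability is assumed: if the integrals of the positive and negative parts are both
    infinite, their difference is -oo by convention on both sides. *)
Lemma integral_pmulEl d (T : measurableType d) (R : realType)
    (mu : {measure set T -> \bar R}) (f : T -> \bar R) (c : R) : 0 < c ->
  (\int[mu]_x (c%:E * f x) = c%:E * \int[mu]_x f x)%E.
Proof.
move=> c0; rewrite [LHS]integralE [in RHS]integralE.
rewrite (ge0_funeposM _ (ltW c0)) (ge0_funenegM _ (ltW c0)).
rewrite !lower_integralZl//.
have: (0 <= \int[mu]_x f^\+ x)%E by exact: integral_ge0.
have: (0 <= \int[mu]_x f^\- x)%E by exact: integral_ge0.
case: (integral _ _ _) => [y| |] //; case: (integral _ _ _) => [x| |] // _ _.
- by rewrite muleBr.
- by rewrite /= gt0_muley ?lte_fin.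
- by rewrite /= gt0_muley ?gt0_muleNy ?lte_fin.
- by rewrite gt0_muley ?lte_fin//= gt0_muleNy ?lte_fin.
Qed.

Lemma integral_mscale_pos d (T : measurableType d) (R : realType)
    (mu : {measure set T -> \bar R}) (f : T -> \bar R) (k : {nonneg R}) :
  0 < k%:num -> (\int[mscale k mu]_x f x = k%:num%:E * \int[mu]_x f x)%E.
Proof.
move=> k0; rewrite -integral_pmulEl// [LHS]integralE [in RHS]integralE.
rewrite (ge0_funeposM _ (ltW k0)) (ge0_funenegM _ (ltW k0)).
by rewrite !lower_integralZl// !lower_integral_mscale.
Qed.

Lemma Rintegral_pmulEl d (T : measurableType d) (R : realType)
    (mu : {measure set T -> \bar R}) (f : T -> R) (c : R) : 0 < c ->
  \int[mu]_x (c * f x) = c * \int[mu]_x f x.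
Proof.
move=> c0; rewrite /Rintegral -fine_pmulEl//; congr fine.
by under eq_integral do rewrite EFinM; rewrite integral_pmulEl.
Qed.

Lemma Rintegral_mscale_pos d (T : measurableType d) (R : realType)
    (mu : {measure set T -> \bar R}) (f : T -> R) (k : {nonneg R}) :
  0 < k%:num -> \int[mscale k mu]_x f x = k%:num * \int[mu]_x f x.
Proof. by move=> k0; rewrite /Rintegral integral_mscale_pos// fine_pmulEl. Qed.

(** * Chain rule for functions of class C^1 on open subsets of R^n *)

Section cvg_sum_prod.
Context {R : realType} {T I : Type} {F : set_system T} {FF : Filter F}.
Variables (r : seq I) (f : I -> T -> R) (l : I -> R).
Hypothesis fl : forall i, f i x @[x --> F] --> l i.

Lemma cvgr_sum : \sum_(i <- r) f i x @[x --> F] --> \sum_(i <- r) l i.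
Proof. by apply: cvg_big => //; exact: add_continuous. Qed.

Lemma cvgr_prod : \prod_(i <- r) f i x @[x --> F] --> \prod_(i <- r) l i.
Proof. by apply: cvg_big => //; exact: mul_continuous. Qed.

End cvg_sum_prod.

Section calculus.
Context {R : realType} {n : nat}.
Implicit Types (F : 'rV[R]_n -> R) (U : set 'rV[R]_n) (u v w k : 'rV[R]_n).

Lemma coord_le_norm k j : `|k 0 j| <= `|k|.
Proof.
rewrite [leRHS]/Num.Def.normr/= mx_normrE.
exact: (le_bigmax _ (fun ij : 'I_1 * 'I_n => `|k ij.1 ij.2|) (0, j)).
Qed.

Lemma norm_le_coord k (a : R) : 0 <= a -> (forall j, `|k 0 j| <= a) -> `|k| <= a.
Proof.
move=> a0 ka; rewrite [leLHS]/Num.Def.normr/= mx_normrE bigmax_le// => -[i j] _ /=.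
by rewrite (ord1 i).
Qed.

Lemma is_derive_line F w v (s : R) : derivable F (w + s *: v) v ->
  is_derive s 1 (fun r : R => F (w + r *: v)) ('D_v F (w + s *: v)).
Proof.
have E : (fun h : R => h^-1 *: (F (w + (h *: 1 + s) *: v) - F (w + s *: v)))
    = (fun h : R => h^-1 *: (F (h *: v + (w + s *: v)) - F (w + s *: v))).
  by apply/funext => h; rewrite [h *: 1]mulr1 scalerDl addrCA.
by move=> dF; apply: DeriveDef; rewrite /derivable /derive /= E.
Qed.

Lemma MVT_line F w v (s : R) :
  (forall r : R, `|r| <= `|s| -> derivable F (w + r *: v) v) ->
  exists2 r, `|r| <= `|s| & F (w + s *: v) - F w = 'D_v F (w + r *: v) * s.
Proof.
move=> dF; set f := fun r : R => F (w + r *: v).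
have df (r : R) : `|r| <= `|s| -> is_derive r 1 f ('D_v F (w + r *: v)).
  by move=> rs; apply: is_derive_line; exact: dF.
have cf (a b : R) : (forall r, r \in `[a, b] -> `|r| <= `|s|) ->
    {within `[a, b], continuous f}.
  move=> ab; apply: continuous_in_subspaceT => r /[!inE] /ab rs.
  apply/differentiable_continuous/derivable1_diffP.
  by have [] := df _ rs.
have f0 : f 0 = F w by rewrite /f scale0r addr0.
have [s0|s0] := leP 0 s.
  have sb r : r \in `[0, s] -> `|r| <= `|s|.
    by rewrite in_itv/= => /andP[r0 rs]; rewrite !ger0_norm.
  have [r rI|r /sb rs E] :=
      @MVT_segment R f (fun r => 'D_v F (w + r *: v)) 0 s s0 _ (cf _ _ sb).
    by apply: df; apply: sb; apply: subset_itv_oo_cc rI.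
  by exists r => //; rewrite -f0 E subr0.
have sb r : r \in `[s, 0] -> `|r| <= `|s|.
  by rewrite in_itv/= => /andP[r0 rs]; rewrite ler0_norm// ltr0_norm// lerN2.
have [r rI|r /sb rs E] :=
    @MVT_segment R f (fun r => 'D_v F (w + r *: v)) s 0 (ltW s0) _ (cf _ _ sb).
  by apply: df; apply: sb; apply: subset_itv_oo_cc rI.
by exists r => //; rewrite -f0 -opprB E sub0r mulrN opprK.
Qed.

(* The vertices of the path from 0 to k that changes one coordinate at a time. *)
Definition cut_vec k (m : nat) : 'rV[R]_n :=
  \row_j (if (j < m)%N then k 0 j else 0).

Lemma cut_vecS k (j : 'I_n) :
  cut_vec k j.+1 = cut_vec k j + k 0 j *: basis_vec R j.
Proof.
apply/rowP => i; rewrite !mxE eqxx/= ltnS leq_eqVlt.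
have [->|ij] := eqVneq i j; first by rewrite eqxx ltnn/= add0r mulr1.
by rewrite (negbTE (_ : val i != val j))//= mulr0 addr0.
Qed.

Lemma norm_cut_vec k (j : 'I_n) (r : R) : `|r| <= `|k| ->
  `|cut_vec k j + r *: basis_vec R j| <= `|k|.
Proof.
move=> rk; apply: norm_le_coord => // i; rewrite !mxE eqxx/=.
have [->|ij] := eqVneq i j; first by rewrite ltnn add0r mulr1.
rewrite mulr0 addr0; case: ifPn => _; first exact: coord_le_norm.
by rewrite normr0.
Qed.

(** The increment is telescoped along the path of [cut_vec], and each edge is handled by the mean
    value theorem in one coordinate direction. The norm is the maximum norm, so the path stays
    within distance |k| of u. *)
Lemma partials_approx F u (e d : R) : 0 <= e ->
  (forall w, `|w - u| < d -> forall j, derivable F w (basis_vec R j)) ->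
  (forall w, `|w - u| < d -> forall j, `|partial j F w - partial j F u| <= e) ->
  forall k, `|k| < d ->
  `|F (u + k) - F u - \sum_j k 0 j * partial j F u| <= n%:R * e * `|k|.
Proof.
move=> e0 dF pF k kd.
have -> : F (u + k) - F u =
    \sum_(j < n) (F (u + cut_vec k j.+1) - F (u + cut_vec k j)).
  rewrite -(big_mkord xpredT (fun j => F (u + cut_vec k j.+1) - F (u + cut_vec k j))).
  rewrite telescope_sumr//; congr (F (u + _) - F _).
    by apply/rowP => j; rewrite mxE ltn_ord.
  by rewrite (_ : cut_vec k 0 = 0) ?addr0//; apply/rowP => j; rewrite !mxE.
rewrite -sumrB (le_trans (ler_norm_sum _ _ _))//.
rewrite [leRHS](_ : _ = \sum_(j < n) e * `|k|); last first.
  by rewrite sumr_const card_ord -[RHS]mulr_natl mulrA.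
rewrite ler_sum// => j _.
rewrite cut_vecS addrA.
have nearP r : `|r| <= `|k 0 j| -> `|u + cut_vec k j + r *: basis_vec R j - u| < d.
  move=> rk; rewrite -(addrA u) [u + _ - u]addrC addKr (le_lt_trans _ kd)//.
  by apply: norm_cut_vec; exact: le_trans rk (coord_le_norm _ _).
have [r rk|r rk ->] := @MVT_line F (u + cut_vec k j) (basis_vec R j) (k 0 j).
  by apply: dF; exact: nearP.
rewrite [k 0 j * _]mulrC -mulrBl normrM ler_pM//; last exact: coord_le_norm.
by apply: pF; exact: nearP.
Qed.

Definition row_form (g : 'rV[R]_n) v : R := \sum_j v 0 j * g 0 j.

Lemma row_form_is_linear g : linear (row_form g).
Proof.
move=> a u v; rewrite /row_form scaler_sumr -big_split/=.
by apply: eq_bigr => j _; rewrite !mxE mulrDl -mulrA.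
Qed.

HB.instance Definition _ g :=
  GRing.isLinear.Build R 'rV[R]_n R _ (row_form g) (row_form_is_linear g).

Lemma row_form_continuous g : continuous (row_form g).
Proof.
move=> u; apply: (@cvgr_sum _ _ _ (nbhs u) (nbhs_filter u)) => j.
by apply: cvgMl; exact: coord_continuous.
Qed.

Lemma C1_is_diff F U u : open U -> Ck_on 1 U F -> U u ->
  differentiable F u /\ 'd F u = row_form (\row_j partial j F u) :> (_ -> _).
Proof.
move=> oU [_ /= CF] Uu; set df := row_form _.
have E (e : R) : 0 < e ->
    \forall k \near (0 : 'rV[R]_n), `|F (k + u) - (F u + df k)| <= e * `|k|.
  move=> e0.
  (* The n coordinates contribute n e' <= e; n + 1 avoids a division by zero in dimension 0. *)
  pose e' := e / n.+1%:R.
  have e'0 : 0 < e' by rewrite divr_gt0.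
  have /nbhs_ballP[d /= d0 dU] : \forall w \near u, U w /\
      forall j, `|partial j F w - partial j F u| <= e'.
    apply: filterS2 (open_nbhs_nbhs (conj oU Uu)) _ => [w|]; first exact: conj.
    apply: (@filter_forall _ _ 
      (fun j w => `|partial j F w - partial j F u| <= e') (nbhs u)) => j.
    have [_ [/(_ u Uu) cj _]] := CF j.
    have /cvgrPdist_le/(_ _ e'0) := cj.
    by apply: filterS => w; rewrite distrC.
  have nearP w : `|w - u| < d -> U w /\
      forall j, `|partial j F w - partial j F u| <= e'.
    by move=> wd; apply: dU; rewrite -ball_normE/= distrC.
  near=> k; have kd : `|k| < d.
    near: k; apply/nbhs_ballP; exists d => //= y.
    by rewrite -ball_normE /= sub0r normrN.
  rewrite opprD addrA [k + u]addrC.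
  have -> : df k = \sum_j k 0 j * partial j F u.
    by apply: eq_bigr => j _; rewrite mxE.
  apply: le_trans (partials_approx (ltW e'0) _ _ kd) _.
  - by move=> w /nearP[Uw _] j; have [/(_ w Uw)] := CF j.
  - by move=> w /nearP[].
  rewrite ler_wpM2r// /e' mulrCA ler_piMr ?(ltW e0)//.
  by rewrite ler_pdivrMr// mul1r ler_nat.
have D : 'd F u = df :> (_ -> _).
  by apply: diff_unique; [exact: row_form_continuous|exact/eqaddoP].
split; last exact: D.
apply/diff_locallyP; rewrite D; split; last exact/eqaddoP.
exact: row_form_continuous.
Unshelve. all: by end_near. Qed.

(** As h is only assumed derivable in the direction v, it is restricted to the line through t: there
    it is a function of one real variable, hence differentiable, and the rule for composed
    differentials applies. *)
Lemma derive_chain {V : normedModType R} F U (h : V -> 'rV[R]_n) (t v : V) :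
  open U -> Ck_on 1 U F -> U (h t) -> derivable h t v ->
  derivable (F \o h) t v /\ 'D_v (F \o h) t = \sum_j 'D_v h t 0 j * partial j F (h t).
Proof.
move=> oU CF Uht /derivable1P dh.
have D1 (W : normedModType R) (f : V -> W) :
    'D_v f t = 'D_1 (fun s : R => f (s *: v + t)) 0.
  rewrite /derive; set p := fun _ => _; set q := fun _ => _.
  suff -> : p = q by []; apply/funext => s; rewrite /p /q /=.
  by rewrite addr0 scale0r add0r [s *: 1]mulr1.
pose g (s : R) := h (s *: v + t); rewrite derivable1P !D1 -/g -/(F \o g).
have g0 : g 0 = h t by rewrite /g scale0r add0r.
have [dF E] : differentiable F (g 0) /\
    'd F (g 0) = row_form (\row_j partial j F (g 0)) :> (_ -> _).
  by apply: C1_is_diff oU CF _; rewrite g0.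
have dg : differentiable g 0 by exact/derivable1_diffP.
have dFg : differentiable (F \o g) 0 by exact: differentiable_comp.
split; first exact/derivable1_diffP.
rewrite [LHS](deriveE _ dFg) diff_comp// /= E deriveE// -g0.
by apply: eq_bigr => j _; rewrite mxE.
Qed.

End calculus.

(** * The Riemannian distance is small near the diagonal *)

Section charts.
Context {R : realType} {n : nat} {M : riemannian_manifold R n}.
Implicit Types (c : chart R n M) (x y z : M) (u w : 'rV[R]_n).

Lemma cinv_dom c u : (cmap c @` cdom c) u ->
  cdom c (cinv c u) /\ cmap c (cinv c u) = u.
Proof. by move=> [y yc <-]; rewrite cmapK. Qed.

Lemma nbhs_cdom c x : cdom c x -> nbhs x (cdom c).
Proof. by move=> xc; apply: open_nbhs_nbhs; split => //; exact: cdom_open. Qed.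

Lemma nbhs_cimg c u : (cmap c @` cdom c) u -> nbhs u (cmap c @` cdom c).
Proof. by move=> uc; apply: open_nbhs_nbhs; split => //; exact: cimg_open. Qed.

Lemma overlap_open c c' : open (cmap c @` (cdom c `&` cdom c')).
Proof.
rewrite openE => u [x [xc xc'] <-].
have xI : (cmap c @` cdom c) (cmap c x) by exists x.
have n1 := nbhs_cimg xI.
have n2 : \forall u \near cmap c x, cdom c' (cinv c u).
  have := cinv_continuous xI; apply.
  by rewrite cmapK//; exact: nbhs_cdom xc'.
apply: filterS2 n1 n2 => v /cinv_dom[vc vE] vc'.
by exists (cinv c v).
Qed.

Lemma is_derive_affine u w (t : R) : is_derive t 1 (fun s : R => u + s *: w) w.
Proof.
have E : forall h : R, h != 0 ->
    h^-1 *: (u + (h *: 1 + t) *: w - (u + t *: w)) = w.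
  move=> h h0; rewrite [h *: 1]mulr1 opprD addrACA subrr add0r scalerDl addrK.
  by rewrite scalerA mulVf// scale1r.
have C : h^-1 *: (u + (h *: 1 + t) *: w - (u + t *: w)) @[h --> (0 : R)^'] --> w.
  apply: cvg_near_cst; near=> h; apply: E; near: h; exact: nbhs_dnbhs_neq.
by apply: DeriveDef; [apply/cvg_ex; exists w|exact: cvg_lim C].
Unshelve. all: by end_near. Qed.

Lemma curve_coord_segment c c' u w (t : R) (j : 'I_n) :
  atlas c -> atlas c' -> (cmap c @` (cdom c `&` cdom c')) (u + t *: w) ->
  let g (s : R) := cinv c (u + s *: w) in
  let F u := transition c c' u 0 j in
  derivable (curve_coord c' g j) t 1 /\
  derive1 (curve_coord c' g j) t = \sum_i w 0 i * partial i F (u + t *: w).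
Proof.
move=> ac ac' Wt g F.
have [dh hE] := is_derive_affine u w t.
have CF : Ck_on 1 (cmap c @` (cdom c `&` cdom c')) F.
  exact: transition_smooth.
have [dc dE] := @derive_chain _ _ _ _ _ (fun s : R => u + s *: w) t 1
  (@overlap_open c c') CF Wt dh.
by split => //; rewrite derive1E [LHS]dE hE.
Qed.

(** [C1_curve] asks for regularity in every chart of the atlas: in another chart the derivative of
    the segment is, near t, a combination of the partial derivatives of the transition map. The
    interval ]-1, 2[ is the neighbourhood of [0, 1] that the definition requires. *)
Lemma segment_C1 c u w : atlas c ->
  (forall t : R, -1 < t < 2 -> (cmap c @` cdom c) (u + t *: w)) ->
  C1_curve (fun t : R => cinv c (u + t *: w)).
Proof.
move=> ac hI; exists 1 => // t tI.
have {hI}It : (cmap c @` cdom c) (u + t *: w) by apply: hI.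
have ch : {for t, continuous (fun t : R => u + t *: w)}.
  apply/differentiable_continuous/derivable1_diffP.
  by have [] := is_derive_affine u w t.
split.
  by apply: continuous_comp; [exact: ch|exact: cinv_continuous].
move=> c' j ac' gc'.
have Wt : (cmap c @` (cdom c `&` cdom c')) (u + t *: w).
  by have [tc tE] := cinv_dom It; exists (cinv c (u + t *: w)).
split; first by have [] := curve_coord_segment j ac ac' Wt.
set F := fun u => transition c c' u 0 j.
have CF : Ck_on 1 (cmap c @` (cdom c `&` cdom c')) F.
  exact: transition_smooth.
rewrite /prop_for /continuous_at (curve_coord_segment j ac ac' Wt).2.
have nW := open_nbhs_nbhs (conj (@overlap_open c c') Wt).
have E : \forall s \near t, \sum_i w 0 i * partial i F (u + s *: w) =
   derive1 (curve_coord c' (fun t : R => cinv c (u + t *: w)) j) s.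
  near=> s; have Ws : (cmap c @` (cdom c `&` cdom c')) (u + s *: w).
    by near: s; exact: ch.
  by rewrite (curve_coord_segment j ac ac' Ws).2.
apply: cvg_trans (near_eq_cvg E) _.
apply: (@cvgr_sum _ _ _ (nbhs t) (nbhs_filter t)) => i; apply: cvgMr.
have [_ [ci _]] := CF.2 i.
by have := continuous_comp ch (ci _ Wt).
Unshelve. all: by end_near. Qed.

(** [velocity] is expressed in a chart that varies with t; compatibility of the metric brings the
    norm back to the chart of the segment. *)
Lemma tnorm_velocity_segment c u w (t : R) : atlas c ->
  (cmap c @` cdom c) (u + t *: w) ->
  let g (s : R) := cinv c (u + s *: w) in
  tnorm (g t) (velocity g t) =
    Num.sqrt ((w *m metric c (u + t *: w) *m w^T) 0 0).
Proof.
move=> ac It g; rewrite /tnorm /tinner; congr (Num.sqrt (_ 0 0)).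
set c' := chart_at (g t).
have ac' : atlas c' by exact: chart_at_atlas.
have Wt : (cmap c @` (cdom c `&` cdom c')) (u + t *: w).
  have [tc tE] := cinv_dom It; exists (cinv c (u + t *: w)) => //.
  by split => //; exact: chart_at_dom.
have -> : velocity g t = w *m jac (transition c c') (u + t *: w).
  apply/rowP => j; rewrite !mxE (curve_coord_segment j ac ac' Wt).2.
  by apply: eq_bigr => i _; rewrite !mxE.
by rewrite (metric_compat ac ac' Wt) trmx_mul !mulmxA.
Qed.

Lemma quad_form_le (A : 'M[R]_n) w (K : R) :
  (forall i j, `|A i j| <= K) ->
  (w *m A *m w^T) 0 0 <= n%:R ^+ 2 * K * `|w| ^+ 2.
Proof.
move=> AK; rewrite mxE; under eq_bigr do rewrite !mxE mulr_suml.
apply: le_trans (_ : \sum_(j < n) \sum_(i < n) K * `|w| ^+ 2 <= _); last first.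
  by rewrite !sumr_const card_ord -[leLHS]mulr_natl -(mulr_natl (K * _)) expr2 !mulrA.
apply: ler_sum => j _; apply: ler_sum => i _.
rewrite (le_trans (ler_norm _))// !normrM mulrAC mulrC expr2.
by apply: ler_pM => //; apply: ler_pM => //; exact: coord_le_norm.
Qed.

(** Comparison with a constant uses no measurability of the speed; it also shows that the integral
    is finite, so that [fine] preserves the bound. *)
Lemma curve_length_le (g : R -> M) (B : R) :
  (forall t : R, 0 <= t <= 1 -> tnorm (g t) (velocity g t) <= B) ->
  curve_length g <= B.
Proof.
move=> gB; have B0 : 0 <= B.
  by apply: le_trans (gB 0 _); rewrite ?sqrtr_ge0// lexx ler01.
rewrite /curve_length /Rintegral.
set I := (X in fine X); have I0 : (0 <= I)%E.
  by apply: integral_ge0 => t _; rewrite lee_fin sqrtr_ge0.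
suff IB : (I <= B%:E)%E by rewrite -lee_fin fineK// ge0_fin_numE// (le_lt_trans IB)// ltry.
have <- : (\int[@lebesgue_measure R]_(t in `[0%R, 1%R]) (cst B%:E t) = B%:E)%E.
  rewrite integral_cst//= lebesgue_measure_itv/= lte_fin ltr01.
  by rewrite sube0 mule1.
rewrite /I integral_mkcond [leRHS]integral_mkcond.
apply: le_lower_integral => t; rewrite /patch; case: ifPn => // /set_mem/=.
  by rewrite lee_fin sqrtr_ge0.
by rewrite in_itv/= => t01; rewrite lee_fin gB.
Qed.

(* Any two points of a small coordinate ball are joined by a segment. *)
Lemma rdist_near x (e : R) : 0 < e ->
  exists2 V : set M, nbhs x V & forall y z, V y -> V z -> (rdist y z < e%:E)%E.
Proof.
move=> e0; pose c := chart_at x; pose u0 := cmap c x.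
have ac : atlas c by exact: chart_at_atlas.
have xc : cdom c x by exact: chart_at_dom.
have Iu0 : (cmap c @` cdom c) u0 by exists x.
(* The summand 1 leaves room for continuity at u0, and gives K <= K * K below. *)
pose K := 1 + \sum_i \sum_j `|metric c u0 i j|.
have K1 : 1 <= K by rewrite lerDl; do 2 apply: sumr_ge0 => ? _.
have : \forall u \near u0, (cmap c @` cdom c) u /\
    forall ij : 'I_n * 'I_n, `|metric c u ij.1 ij.2| <= K.
  apply: filterS2 (nbhs_cimg Iu0) _ => [u|]; first exact: conj.
  apply: (@filter_forall _ _ (fun (ij : 'I_n * 'I_n) u => `|metric c u ij.1 ij.2| <= K) (nbhs u0)).
  move=> [i j] /=; have [+ _] := metric_smooth ac i j 0 => /(_ _ Iu0) cij.
  have /cvg_norm/cvgr_le := cij; apply; rewrite /K ltr_pwDl//.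
  rewrite (bigD1 i)//= (bigD1 j)//= -addrA lerDl addr_ge0//.
    exact: sumr_ge0.
  by do 2 apply: sumr_ge0 => ? _.
move=> /nbhs_ballP[d /= d0 dI].
(* For -1 < t < 2 both |1 - t| and |t| are at most 2, so the extended segment stays within 4 r <= d
   of u0. Its direction has norm at most 2 r, so the speed is at most 2 (n + 1) K r <= e / 2. *)
pose r := Num.min (d / 4) (e / (4 * n.+1%:R * K)).
have r0 : 0 < r by rewrite lt_min !divr_gt0// !mulr_gt0// (lt_le_trans ltr01).
exists (cdom c `&` [set y | `|cmap c y - u0| < r]).
  apply: filterI; first exact: nbhs_cdom xc.
  have /cvgrPdist_lt/(_ _ r0) := cmap_continuous xc.
  by apply: filterS => y; rewrite distrC.
move=> y z [yc /= yr] [zc /= zr].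
set u := cmap c y; pose w := cmap c z - u.
have hd (t : R) : -1 < t < 2 -> `|u + t *: w - u0| < d.
  move=> /andP[t1 t2].
  rewrite (_ : _ - u0 = (1 - t) *: (u - u0) + t *: (cmap c z - u0)); last first.
    rewrite /w !scalerBr !scalerBl !scale1r.
    by apply/rowP => j; rewrite !mxE; ring.
  have r4 : 4 * r <= d by rewrite mulrC -ler_pdivlMr// ge_min lexx.
  rewrite (le_lt_trans (ler_normD _ _))// (lt_le_trans _ r4)// !normrZ.
  have : `|1 - t| <= 2 by rewrite ler_norml; apply/andP; split; lra.
  have : `|t| <= 2 by rewrite ler_norml; apply/andP; split; lra.
  move=> a b.
  have := ler_wpM2r (normr_ge0 (u - u0)) b.
  have := ler_wpM2r (normr_ge0 (cmap c z - u0)) a.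
  by move: yr zr; rewrite -/u; lra.
have hI (t : R) : -1 < t < 2 -> (cmap c @` cdom c) (u + t *: w) /\
    forall i j, `|metric c (u + t *: w) i j| <= K.
  move=> /hd td; have := dI (u + t *: w); rewrite -ball_normE/= distrC.
  by move=> /(_ td)[? h]; split => // i j; exact: (h (i, j)).
pose g (t : R) := cinv c (u + t *: w).
have gC1 : C1_curve g by apply: segment_C1 => // t /hI[].
have g0 : g 0 = y by rewrite /g scale0r addr0 cmapK.
have g1 : g 1 = z by rewrite /g scale1r /w addrC subrK cmapK.
have wr : `|w| <= 2 * r.
  have -> : w = (cmap c z - u0) - (u - u0) by rewrite opprB addrA subrK.
  rewrite (le_trans (ler_normB _ _))//; move: (ltW yr) (ltW zr); rewrite -/u; lra.
have len : curve_length g <= e / 2.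
  apply: curve_length_le => t /andP[t0 t1].
  have [It Kt] : (cmap c @` cdom c) (u + t *: w) /\
    forall i j, `|metric c (u + t *: w) i j| <= K by apply: hI; apply/andP; split; lra.
  rewrite tnorm_velocity_segment// -(@ger0_norm _ (e / 2)) ?divr_ge0 ?(ltW e0)// -sqrtr_sqr.
  have e2 : 0 <= e / 2 by lra.
  rewrite ler_sqrt ?exprn_ge0//.
  apply: le_trans (quad_form_le _ Kt) _.
  have K0 : 0 < K by lra.
  have rE : 2 * n.+1%:R * K * r <= e / 2.
    have : r <= e / (4 * n.+1%:R * K) by rewrite ge_min lexx orbT.
    rewrite ler_pdivlMr ?mulr_gt0//; lra.
  apply: le_trans (_ : (2 * n.+1%:R * K * r) ^+ 2 <= _); last first.
    by rewrite ler_sqr ?nnegrE ?mulr_ge0 ?(ltW K0) ?(ltW r0)// ltW// divr_gt0.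
  have -> : (2 * n.+1%:R * K * r) ^+ 2 = n.+1%:R ^+ 2 * (K * K) * (2 * r) ^+ 2 by ring.
  rewrite ler_pM ?mulr_ge0 ?exprn_ge0 ?(ltW K0)//.
    rewrite ler_pM ?exprn_ge0 ?(ltW K0)//; first by rewrite ler_sqr ?nnegrE// ler_nat.
    by rewrite ler_peMr// ltW.
  by rewrite ler_sqr ?nnegrE// mulr_ge0// ltW.
apply: (@le_lt_trans _ _ (curve_length g + 0)%:E); last first.
  by rewrite addr0 lte_fin; lra.
apply: ereal_inf_lbound; exists (curve_length g + 0) => //.
by rewrite -g0; apply: joined_cons => //; rewrite g1; exact: joined_nil.
Qed.

End charts.

(** * Boundedness of |grad eta|^2 + 4 eta^2 for compactly supported eta *)

Section gradient.
Context {R : realType} {n : nat} {M : riemannian_manifold R n}.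
Implicit Types (c : chart R n M) (x y z : M) (u w : 'rV[R]_n) (f : M -> R).

Lemma posdef_unit (A : 'M[R]_n) :
  (forall v : 'rV[R]_n, v != 0 -> 0 < (v *m A *m v^T) 0 0) -> A \in unitmx.
Proof.
move=> pA; rewrite -row_free_unit -kermx_eq0; apply/eqP/row_matrixP => i.
rewrite row0; apply/eqP; apply: contraT => /pA.
by rewrite -row_mul mulmx_ker row0 mul0mx mxE ltxx.
Qed.

Lemma metric_unit c u : atlas c -> (cmap c @` cdom c) u ->
  metric c u \in unitmx.
Proof. by move=> ac Iu; apply: posdef_unit => v; exact: metric_posdef. Qed.

Lemma metric_at_unit x : metric_at x \in unitmx.
Proof.
rewrite /metric_at; apply: metric_unit; first exact: chart_at_atlas.
by exists x => //; exact: chart_at_dom.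
Qed.

Lemma tinner_ge0 x (v : 'rV[R]_n) : 0 <= tinner x v v.
Proof.
have [->|v0] := eqVneq v 0; first by rewrite /tinner !mul0mx mxE.
rewrite /tinner /metric_at; apply/ltW/metric_posdef => //; first exact: chart_at_atlas.
by exists x => //; exact: chart_at_dom.
Qed.

Definition dcoord c f u : 'rV[R]_n := \row_j partial j (f \o cinv c) u.

(** With J the Jacobian of the change of chart, the differential becomes d J^T and the metric J G
    J^T; hence grad f times J is d G^-1 and J disappears. The right-hand side refers to a fixed
    chart, so it can be studied as a function of x. *)
Lemma tinner_grad c f x : atlas c -> cdom c x -> smooth_fun f ->
  let u := cmap c x in
  tinner x (grad f x) (grad f x) =
    (dcoord c f u *m invmx (metric c u) *m (dcoord c f u)^T) 0 0.
Proof.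
move=> ac xc sf u; set cx := chart_at x; set ux := cmap cx x.
have acx : atlas cx by exact: chart_at_atlas.
have xcx : cdom cx x by exact: chart_at_dom.
have uE : transition cx c ux = u by rewrite /transition /ux cmapK.
have Iu : (cmap c @` cdom c) u by exists x.
have Wux : (cmap cx @` (cdom cx `&` cdom c)) ux by exists x.
set J := jac (transition cx c) ux; set G := metric c u.
have gJ : metric_at x = J *m G *m J^T.
  by rewrite /metric_at (metric_compat acx ac Wux) uE.
have Gu : G \in unitmx by exact: metric_unit.
have Ju : J \in unitmx.
  by have := metric_at_unit x; rewrite gJ !unitmx_mul => /andP[/andP[]].
set d := dcoord c f u.
have dE : \row_j partial j (f \o cinv cx) ux = d *m J^T.
  apply/rowP => i; rewrite !mxE.
  have near_eq : \forall v \near ux,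
      (f \o cinv cx) v = ((f \o cinv c) \o transition cx c) v.
    have nW : nbhs ux (cmap cx @` (cdom cx `&` cdom c)).
      by apply: open_nbhs_nbhs; split => //; exact: overlap_open.
    by apply: filterS nW => _ [y [yx yc] <-]; rewrite /= /transition !cmapK.
  rewrite /partial (near_eq_derive _ near_eq).
  have dT : derivable (transition cx c) ux (basis_vec R i).
    apply/derivable_mxP => a j; rewrite (ord1 a).
    have [_ /(_ i)[+ _]] := transition_smooth acx ac j 1.
    exact.
  have CF : Ck_on 1 (cmap c @` cdom c) (f \o cinv c) by exact: sf.
  have Iu' : (cmap c @` cdom c) (transition cx c ux) by rewrite uE.
  have oI : open (cmap c @` cdom c) by exact: cimg_open.
  have [_ ->] := derive_chain oI CF Iu' dT.
  apply: eq_bigr => j _; rewrite uE !mxE mulrC /partial; congr (_ * _).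
  by rewrite derive_mx// mxE.
set p := grad f x.
have pg : p *m metric_at x = d *m J^T.
  by rewrite /p /grad -/cx -/ux dE mulmxKV// metric_at_unit.
have pJ : p *m J = d *m invmx G.
  have : p *m J *m G *m J^T = d *m J^T by rewrite -pg gJ !mulmxA.
  move/(congr1 (mulmx^~ (invmx J^T))); rewrite !mulmxK ?unitmx_tr//.
  by move=> <-; rewrite mulmxK.
have GT : G^T = G by exact: Defs.metric_sym.
rewrite /tinner gJ !mulmxA pJ -(mulmxA _ J^T) -trmx_mul pJ trmx_mul.
by rewrite trmx_inv GT !mulmxA mulmxKV.
Qed.

Section mx_cvg.
Context {T : Type} {F : set_system T} {FF : Filter F}.

Lemma cvg_det m (A : T -> 'M[R]_m) (B : 'M[R]_m) :
  (forall i j, A t i j @[t --> F] --> B i j) ->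
  \det (A t) @[t --> F] --> \det B.
Proof.
move=> AB; apply: cvgr_sum => s; apply: cvgMr; exact: cvgr_prod.
Qed.

(** By the cofactor formula, which [invmx] follows on invertible matrices. *)
Lemma cvg_invmx m (A : T -> 'M[R]_m) (B : 'M[R]_m) :
  (forall i j, A t i j @[t --> F] --> B i j) -> B \in unitmx ->
  (\forall t \near F, A t \in unitmx) ->
  forall i j, invmx (A t) i j @[t --> F] --> invmx B i j.
Proof.
move=> AB Bu Au i j.
have E : \forall t \near F, (\det (A t))^-1 * cofactor (A t) j i = invmx (A t) i j.
  by apply: filterS Au => t tu; rewrite /invmx tu !mxE.
apply: cvg_trans (near_eq_cvg E) _.
rewrite /invmx Bu !mxE; apply: cvgM.
  by apply: cvgV; [move: Bu; rewrite unitmxE unitfE|exact: cvg_det].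
apply: cvgMr; apply: cvg_det => k l; rewrite !mxE.
by under eq_cvg do rewrite !mxE; exact: AB.
Qed.

Lemma cvg_inv_form m (d : T -> 'rV[R]_m) (d0 : 'rV[R]_m)
    (G : T -> 'M[R]_m) (G0 : 'M[R]_m) :
  (forall j, d t 0 j @[t --> F] --> d0 0 j) ->
  (forall i j, G t i j @[t --> F] --> G0 i j) ->
  G0 \in unitmx -> (\forall t \near F, G t \in unitmx) ->
  (d t *m invmx (G t) *m (d t)^T) 0 0 @[t --> F] -->
    (d0 *m invmx G0 *m d0^T) 0 0.
Proof.
move=> dd GG G0u Gu; rewrite mxE; under eq_cvg do rewrite mxE.
apply: cvgr_sum => j; rewrite !mxE; under eq_cvg do rewrite !mxE.
apply: cvgM => //; apply: cvgr_sum => i; apply: cvgM => //.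
exact: cvg_invmx.
Qed.

End mx_cvg.

Lemma h1density_near_bounded f x : smooth_fun f ->
  exists B : R, \forall y \near x, h1density (smooth_pair f) (smooth_pair f) y <= B.
Proof.
move=> sf; set c := chart_at x; set u := cmap c x.
have ac : atlas c by exact: chart_at_atlas.
have xc : cdom c x by exact: chart_at_dom.
have Iu : (cmap c @` cdom c) u by exists x.
pose D v := (dcoord c f v *m invmx (metric c v) *m (dcoord c f v)^T) 0 0 +
            4 * (f (cinv c v)) * (f (cinv c v)).
have cD : D v @[v --> u] --> D u.
  have cf : f (cinv c v) @[v --> u] --> f (cinv c u).
    by have [+ _] := sf _ ac 0 => /(_ _ Iu).
  apply: (@cvgD _ _ _ (nbhs u)); last first.
    apply: (@cvgM _ _ (nbhs u)); last exact: cf.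
    exact: (@cvgMr _ _ (nbhs u) _ _ _ _ cf).
  apply: (@cvg_inv_form _ (nbhs u)).
  - move=> j; rewrite mxE; under eq_cvg do rewrite mxE.
    by have [_ /(_ j)[_ [+ _]]] := sf _ ac 1 => /(_ _ Iu).
  - by move=> k l; have [+ _] := metric_smooth ac k l 0 => /(_ _ Iu).
  - exact: metric_unit.
  - by apply: filterS (nbhs_cimg Iu) => v; exact: metric_unit.
exists (D u + 1).
have : \forall v \near u, D v <= D u + 1.
  by apply: (cvgr_le _ cD); rewrite ltrDl.
move/(cmap_continuous xc).
apply: (@filterS2 M (nbhs x) _ _ _ _ _ (nbhs_cdom xc)) => y yc.
by rewrite /= /D cmapK// /h1density /= (tinner_grad ac yc sf).
Qed.

(** On the support, local bounds are made uniform by compactness, stated as near-covering with the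
    bound b tending to +oo as parameter. Off the support f vanishes near the point, so its gradient
    does too. *)
Lemma Cc_infty_bounded f : Cc_infty f ->
  exists2 B : R, 0 <= B &
    forall x, h1density (smooth_pair f) (smooth_pair f) x <= B.
Proof.
move=> [sf /compact_near_coveringP cK].
have h : forall x, closure [set x | f x != 0] x ->
  \forall y \near x & b \near +oo,
    h1density (smooth_pair f) (smooth_pair f) y <= b.
  move=> x _; have [B nB] := h1density_near_bounded x sf.
  exists ([set y | h1density (smooth_pair f) (smooth_pair f) y <= B], [set b | B <= b]).
    by split => //=; apply: nbhs_pinfty_ge; exact: num_real.
  by move=> [y b] /= [yB]; exact: le_trans.
have nB := cK _ _ _ _ h.
have [B [B0 KB]] : exists B, 0 <= B /\
    closure [set x | f x != 0] `<=` [set x | h1density (smooth_pair f) (smooth_pair f) x <= B].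
  have nB0 : \forall b \near +oo, (0 : R) <= b by apply: nbhs_pinfty_ge; exact: num_real.
  by have [B [B0 KB]] := filter_ex (filterI nB0 (nB _)); exists B.
exists B => // x; have [/KB//|nx] := pselect (closure [set x | f x != 0] x).
suff -> : h1density (smooth_pair f) (smooth_pair f) x = 0 by [].
have n0 : \forall y \near x, f y = 0.
  have oC : open (~` closure [set x | f x != 0]) by exact/closed_openC/closed_closure.
  apply: filterS (open_nbhs_nbhs (conj oC nx)) => y /= yK.
  by apply: contrapT => /eqP fy; apply: yK; exact: subset_closure.
have d0 : \row_j partial j (f \o cinv (chart_at x)) (cmap (chart_at x) x) = 0.
  apply/rowP => j; rewrite !mxE /partial.
  have xc := chart_at_dom x.
  have Ix : (cmap (chart_at x) @` cdom (chart_at x)) (cmap (chart_at x) x) by exists x.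
  have E : \forall v \near cmap (chart_at x) x, (f \o cinv (chart_at x)) v = cst 0 v.
    have n0' : nbhs (cinv (chart_at x) (cmap (chart_at x) x)) [set y | f y = 0].
      by rewrite cmapK.
    exact: cinv_continuous Ix _ n0'.
  by rewrite (near_eq_derive _ E) derive_cst.
rewrite /h1density /h1val /h1grad /= /tinner /grad d0 !mul0mx mxE.
by rewrite (nbhs_singleton n0) !mulr0 addr0.
Qed.

End gradient.

(** * The cone *)

Section cone_metric.
Context {R : realType} {n : nat} {M : riemannian_manifold R n}.
Implicit Types (x y z : M) (p q w : cone M).

Lemma joined_ge0 x y l : joined x y l -> 0 <= l.
Proof.
elim=> // g z k _ _ k0; apply: addr_ge0 => //.
by apply: Rintegral_ge0 => t _; exact: sqrtr_ge0.
Qed.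

Lemma joined_trans x y z l l' : joined x y l -> joined y z l' ->
  joined x z (l + l').
Proof.
move=> xy yz; elim: xy yz => [{}x|g {}y k gC _ IH] yz; first by rewrite add0r.
by rewrite -addrA; apply: joined_cons => //; exact: IH.
Qed.

Lemma rdist_ge0 x y : (0 <= rdist x y)%E.
Proof.
by apply: le_ereal_inf_tmp => _ [l /joined_ge0 l0 <-]; rewrite lee_fin.
Qed.

Lemma rdistxx x : rdist x x = 0%E.
Proof.
apply/eqP; rewrite eq_le rdist_ge0 andbT; apply: ereal_inf_lbound.
by exists 0 => //; exact: joined_nil.
Qed.

Lemma rdist_triangle x y z : (rdist x z <= rdist x y + rdist y z)%E.
Proof.
have h l : joined x y l -> (rdist x z <= rdist y z + l%:E)%E.
  move=> xy; rewrite -leeBlDr//; apply: le_ereal_inf_tmp => _ [l' yz <-].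
  rewrite leeBlDr// -EFinD; apply: ereal_inf_lbound; exists (l + l').
    exact: joined_trans yz.
  by rewrite addrC.
have [->|yzoo] := eqVneq (rdist y z) +oo%E.
  by rewrite addey ?leey// gt_eqF// (lt_le_trans _ (rdist_ge0 _ _))// ltNy0.
have yz : rdist y z \is a fin_num by rewrite ge0_fin_numE ?rdist_ge0// ltey.
rewrite -leeBlDr//; apply: le_ereal_inf_tmp => _ [l xy <-].
by rewrite leeBlDr// addeC h.
Qed.

(** The [angle] of two points off the vertex. The cap at pi keeps it finite for points of different
    components, so [fine] loses nothing. *)
Definition capped_dist x y : R := fine (mine (rdist x y) pi%:E).

Lemma capped_distE x y : (capped_dist x y)%:E = mine (rdist x y) pi%:E.
Proof.
rewrite /capped_dist fineK// ge0_fin_numE ?le_min ?rdist_ge0 ?lee_fin ?pi_ge0//.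
by rewrite gt_min ltry orbT.
Qed.

Lemma capped_dist_ge0 x y : 0 <= capped_dist x y.
Proof.
by rewrite -lee_fin capped_distE le_min rdist_ge0 lee_fin pi_ge0.
Qed.

Lemma capped_dist_le_pi x y : capped_dist x y <= pi.
Proof. by rewrite -lee_fin capped_distE ge_min lexx orbT. Qed.

Lemma capped_distxx x : capped_dist x x = 0.
Proof.
apply/eqP; rewrite eq_le capped_dist_ge0 andbT -lee_fin capped_distE rdistxx.
by rewrite ge_min lexx.
Qed.

Lemma capped_dist_triangle x y z :
  capped_dist x z <= capped_dist x y + capped_dist y z.
Proof.
rewrite -lee_fin EFinD !capped_distE.
have [xy|xy] := leP (rdist x y) pi%:E; last first.
  by rewrite ge_min leeDl ?orbT// le_min rdist_ge0 lee_fin pi_ge0.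
have [yz|yz] := leP (rdist y z) pi%:E; last first.
  by rewrite ge_min leeDr ?orbT// rdist_ge0.
by rewrite ge_min rdist_triangle.
Qed.

Lemma plane_triangle (a b c d : R) :
  Num.sqrt ((a + c) ^+ 2 + (b + d) ^+ 2) <=
  Num.sqrt (a ^+ 2 + b ^+ 2) + Num.sqrt (c ^+ 2 + d ^+ 2).
Proof.
have h (u v : R) : 0 <= u ^+ 2 + v ^+ 2 by rewrite addr_ge0// sqr_ge0.
rewrite -ler_sqr ?nnegrE ?sqrtr_ge0 ?addr_ge0 ?sqrtr_ge0//.
rewrite [leRHS]sqrrD !sqr_sqrtr//.
suff : a * c + b * d <= Num.sqrt (a ^+ 2 + b ^+ 2) * Num.sqrt (c ^+ 2 + d ^+ 2).
  by move: (_ * Num.sqrt _) => z; rewrite mulr2n !expr2; lra.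
rewrite -sqrtrM// (le_trans (ler_norm _))// -sqrtr_sqr ler_sqrt ?mulr_ge0//.
(* Lagrange's identity, which gives Cauchy-Schwarz in the plane. *)
rewrite -subr_ge0 (_ : _ - _ = (a * d - b * c) ^+ 2) ?sqr_ge0//; ring.
Qed.

(** Law of cosines: the distance of two points of the plane with polar radii r and s and angle a
    between them. *)
Definition plane_dist (r s a : R) := Num.sqrt (r ^+ 2 + s ^+ 2 - 2 * r * s * cos a).

(** The middle point is put on the axis, the other two on opposite sides of it at angles a and b, so
    that the angle between them is a + b. *)
Lemma plane_dist_triangle (r s t a b : R) :
  plane_dist r t (a + b) <= plane_dist r s a + plane_dist s t b.
Proof.
have := plane_triangle (r * cos a - s) (r * sin a) (s - t * cos b) (t * sin b).
congr (_ <= _ + _); congr Num.sqrt.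
- rewrite cosD.
  transitivity (r ^+ 2 * (cos a ^+ 2 + sin a ^+ 2) + t ^+ 2 * (cos b ^+ 2 + sin b ^+ 2)
    - 2 * r * t * (cos a * cos b - sin a * sin b)); first by ring.
  by rewrite !cos2Dsin2 !mulr1.
- transitivity (r ^+ 2 * (cos a ^+ 2 + sin a ^+ 2) + s ^+ 2 - 2 * r * s * cos a);
    first by ring.
  by rewrite cos2Dsin2 mulr1.
- transitivity (s ^+ 2 + t ^+ 2 * (cos b ^+ 2 + sin b ^+ 2) - 2 * s * t * cos b);
    first by ring.
  by rewrite cos2Dsin2 mulr1.
Qed.

Lemma le_plane_dist (r s a b : R) : 0 <= r -> 0 <= s -> 0 <= a -> a <= b ->
  b <= pi -> plane_dist r s a <= plane_dist r s b.
Proof.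
move=> r0 s0 a0 ab bpi; apply: ler_wsqrtr; rewrite lerD2l lerN2.
rewrite ler_wpM2l ?mulr_ge0//.
move: ab; rewrite le_eqVlt => /predU1P[->//|ab]; apply: ltW.
by rewrite ltr_cos// in_itv/=; apply/andP; split; lra.
Qed.

(* Replacing b by min(b, pi - a) reduces to the triangle inequality in the
   plane. *)
Lemma plane_dist_sum (r s t a b c : R) : 0 <= r -> 0 <= s -> 0 <= t ->
  0 <= a <= pi -> 0 <= b <= pi -> 0 <= c <= pi -> c <= a + b ->
  plane_dist r t c <= plane_dist r s a + plane_dist s t b.
Proof.
move=> r0 s0 t0 /andP[a0 api] /andP[b0 bpi] /andP[c0 cpi] cab.
pose b' := Num.min b (pi - a).
have b'b : b' <= b by rewrite ge_min lexx.
have b'0 : 0 <= b' by rewrite le_min b0 subr_ge0.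
have ab' : a + b' <= pi.
  by rewrite addrC -lerBrDr ge_min lexx orbT.
have cab' : c <= a + b'.
  rewrite /b'; have [?|?] := leP b (pi - a); first by [].
  by rewrite addrC subrK.
apply: le_trans (le_plane_dist r0 t0 c0 cab' ab') _.
apply: le_trans (plane_dist_triangle r s t a b') _.
by rewrite lerD2l; exact: le_plane_dist.
Qed.

Lemma radius_ge0 p : 0 <= radius p.
Proof. by case: p => [[x r]|] /=. Qed.

Lemma dCE p q : dC p q = plane_dist (radius p) (radius q) (angle p q).
Proof. by []. Qed.

Lemma dC_ge0 p q : 0 <= dC p q.
Proof. exact: sqrtr_ge0. Qed.

(** A radial and an angular part, both nonnegative: in this form the square root of [dC] is seen to
    be taken of a nonnegative number, and [dC] compares with the radii. *)
Lemma sqr_dC p q : dC p q ^+ 2 =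
  (radius p - radius q) ^+ 2 + 2 * radius p * radius q * (1 - cos (angle p q)).
Proof.
have r0 := radius_ge0 p; have s0 := radius_ge0 q.
have E : radius p ^+ 2 + radius q ^+ 2 - 2 * radius p * radius q * cos (angle p q) =
  (radius p - radius q) ^+ 2 + 2 * radius p * radius q * (1 - cos (angle p q)) by ring.
rewrite /dC sqr_sqrtr E// addr_ge0 ?sqr_ge0// !mulr_ge0//.
Qed.

Lemma dist_radius_le_dC p q : `|radius p - radius q| <= dC p q.
Proof.
rewrite -ler_sqr ?nnegrE ?dC_ge0// sqr_dC real_normK ?num_real// lerDl.
by rewrite !mulr_ge0 ?radius_ge0// subr_ge0 cos_le1.
Qed.

Lemma dC_le_add p q : dC p q <= radius p + radius q.
Proof.
have r0 := radius_ge0 p; have s0 := radius_ge0 q.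
rewrite -ler_sqr ?nnegrE ?dC_ge0 ?addr_ge0// sqr_dC.
have c := cos_geN1 (angle p q).
have : radius p * radius q * (1 - cos (angle p q)) <= radius p * radius q * 2.
  by rewrite ler_wpM2l ?mulr_ge0//; lra.
by rewrite !expr2; lra.
Qed.

Lemma dCxx p : dC p p = 0.
Proof.
apply/eqP; rewrite -sqrf_eq0 sqr_dC subrr expr0n add0r.
case: p => [[x r]|] /=; last by rewrite !mulr0 mul0r.
by rewrite -/(capped_dist x x) capped_distxx cos0 subrr mulr0.
Qed.

(** Through or from the vertex, distances are compared with radii only; off the vertex it is the
    planar inequality applied to the capped angles. *)
Lemma dC_triangle q p w : dC p w <= dC p q + dC q w.
Proof.
case: p => [[x r]|]; last first.
  have := dist_radius_le_dC q w; have := dist_radius_le_dC (None : cone M) q.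
  have := dC_le_add (None : cone M) w; rewrite /= !sub0r add0r.
  by rewrite !ler_norml; lra.
case: w => [[z t]|]; last first.
  have := dist_radius_le_dC (Some (x, r) : cone M) q; have := dist_radius_le_dC q (None : cone M).
  have := dC_le_add (Some (x, r) : cone M) None; rewrite /= !subr0 addr0.
  by rewrite !ler_norml; lra.
case: q => [[y s]|]; last first.
  have := dist_radius_le_dC (Some (x, r) : cone M) None.
  have := dist_radius_le_dC (None : cone M) (Some (z, t)).
  have := dC_le_add (Some (x, r) : cone M) (Some (z, t)).
  by rewrite /= subr0 sub0r !ler_norml; lra.
rewrite !dCE /= -!/(capped_dist _ _).
apply: plane_dist_sum => //; rewrite ?capped_dist_ge0 ?capped_dist_le_pi//.
exact: capped_dist_triangle.
Qed.

End cone_metric.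

Lemma measurable_fun_gen d (T : measurableType d) (Y : pointedType)
    (G : set (set Y)) (f : T -> g_sigma_algebraType G) :
  (forall U, G U -> measurable (f @^-1` U)) -> measurable_fun setT f.
Proof.
move=> h; apply: (@measurability _ _ _ _ _ f G) => // _ [U GU <-].
by rewrite setTI; exact: h.
Qed.

(** * Borel structure of the cone and of its square *)

Section cone_borel.
Context {R : realType} {n : nat} {M : riemannian_manifold R n}.
Implicit Types (x y z : M) (p q w : cone M) (r s : {posnum R}).

Lemma cone_ptE x r : cone_pt x r%:num = Some (x, r).
Proof.
rewrite /cone_pt; case: {-}_ / idP => [r0|/negP]; last by rewrite gt0.
by congr (Some (x, _)); apply/val_inj.
Qed.

Lemma cone_pt_pos x (r : R) (r0 : 0 < r) : cone_pt x r = Some (x, PosNum r0).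
Proof. exact: (cone_ptE x (PosNum r0)). Qed.

Lemma cone_pt0 x : cone_pt x (0 : R) = None.
Proof.
by rewrite /cone_pt; case: {-}_ / idP => // r0; have := r0; rewrite ltxx.
Qed.

Lemma radius_cone_pt x (r : R) : 0 <= r -> radius (cone_pt x r) = r.
Proof.
rewrite le_eqVlt => /predU1P[<-|r0]; last by rewrite cone_pt_pos.
by rewrite cone_pt0.
Qed.

Lemma dC_same_base x r s :
  dC (Some (x, r) : cone M) (Some (x, s)) = `|r%:num - s%:num|.
Proof.
apply/eqP; rewrite -(@eqrXn2 _ 2%N) ?dC_ge0// sqr_dC/= -/(capped_dist x x).
by rewrite capped_distxx cos0 subrr mulr0 addr0 real_normK ?num_real.
Qed.

Lemma dC_near x r (e : R) : 0 < e -> exists2 V : set M, nbhs x V &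
  forall y z, V y -> V z -> dC (Some (y, r) : cone M) (Some (z, r)) < e.
Proof.
move=> e0; pose e' := e ^+ 2 / (2 * r%:num ^+ 2).
have e'0 : 0 < e' by rewrite divr_gt0 ?mulr_gt0 ?exprn_gt0.
have /cvgrPdist_lt/(_ _ e'0)/nbhs_ballP[d /= d0 dc] := @continuous_cos R 0.
have [V xV dV] := rdist_near x d0; exists V => // y z Vy Vz.
have yz : capped_dist y z < d.
  by rewrite -lte_fin capped_distE gt_min dV.
have /= := dc (capped_dist y z); rewrite cos0 -ball_normE/= sub0r normrN.
rewrite ger0_norm ?capped_dist_ge0// => /(_ yz).
rewrite ger0_norm ?subr_ge0 ?cos_le1// => cyz.
rewrite -(@ltr_pXn2r _ 2%N) ?nnegrE ?dC_ge0 ?(ltW e0)//.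
rewrite sqr_dC/= subrr expr0n add0r -/(capped_dist y z) mulrC -ltr_pdivlMr ?mulr_gt0//.
by rewrite -mulrA -expr2.
Qed.

Lemma dC_open_ball p (e : R) : dC_open [set q | dC p q < e].
Proof.
move=> q /= pq; exists (e - dC p q); first by rewrite subr_gt0.
by move=> w qw; have := dC_triangle q p w; lra.
Qed.

Lemma dC_open_measurable (U : set (cone M)) :
  dC_open U -> measurable (U : set (borelC M)).
Proof. by move=> oU; apply: sub_sigma_algebra. Qed.

Lemma dC2_open_measurable (U : set (cone M * cone M)) :
  dC2_open U -> measurable (U : set (borelCC M)).
Proof. by move=> oU; apply: sub_sigma_algebra. Qed.

(** This links the Borel sets of M, which come from its topology, to those of the cone, which come
    from [dC]: the slice at radius r is continuous. *)
Lemma measurable_cone_pt r :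
  measurable_fun setT ((fun x => cone_pt x r%:num) : borelM M -> borelC M).
Proof.
apply: measurable_fun_gen => U oU; apply: sub_sigma_algebra.
rewrite openE => x; rewrite /= cone_ptE => Ux.
have [e e0 eU] := oU _ Ux; have [V xV dV] := dC_near x r e0.
have Vx := nbhs_singleton xV; apply: filterS xV => y Vy /=; rewrite cone_ptE; apply: eU.
exact: dV.
Qed.

Lemma measurable_radius : measurable_fun setT ((fun p => radius p) : borelC M -> R).
Proof.
apply: (measurability _ (RGenOInfty.measurableE R)) => _ [_ [a ->] <-].
rewrite setTI; apply: dC_open_measurable => p /=; rewrite in_itv/= andbT => ap.
exists (radius p - a); first by rewrite subr_gt0.
move=> q pq; rewrite /= in_itv/= andbT.
by have := dist_radius_le_dC p q; rewrite ler_norml; lra.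
Qed.

(* Balls with rational radii, centered at points with rational radius over a
   countable dense subset of M. The triangle inequality is used with its
   arguments in order, because symmetry of [rdist] is not needed. *)
Lemma countable_dC_base : exists N : nat -> set (cone M),
  (forall k, dC_open (N k)) /\
  forall p (e : R), 0 < e ->
    exists2 k, N k p & N k `<=` [set q | dC p q < e].
Proof.
have [B cB [_ B_basis]] := @carrier_second_countable R n M.
have /countable_injP[f f_inj] := cB.
pose Bm k : set M := xget set0 [set U | B U /\ f U = k].
have BmE U : B U -> Bm (f U) = U.
  move=> BU; rewrite /Bm; case: xgetP => [V _ [BV fV]|/(_ U)]; last by case.
  by apply: f_inj => //; apply: mem_set.
pose center (o : option (nat * rat)) : cone M :=
  if o is Some (k, a) then cone_pt (xget point (Bm k)) (ratr a) else None.
pose N k : set (cone M) :=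
  if unpickle k is Some (c, a) then [set q | dC (center c) q < ratr a] else set0.
exists N; split => [k|p e e0].
  rewrite /N; case: unpickle => [[c a]|]; first exact: dC_open_ball.
  by move=> ? [].
case: p => [[x r]|]; last first.
  have [a] := rat_in_itvoo e0; rewrite in_itv/= => /andP[a0 ae].
  exists (pickle ((None, a) : option (nat * rat) * rat)); rewrite /N pickleK/=.
    by rewrite dCxx.
  by move=> q /=; lra.
(* The centre c will be within e/8 + e/8 = e/4 of (x, r) in both orders, and the radius a between
   e/4 and e/2. Thus the ball about c contains (x, r), and its points are within e/4 + e/2 < e of
   (x, r). *)
have e8 : 0 < e / 8 by lra.
have [V xV dV] := dC_near x r e8.
have [U [BU Ux] UV] := B_basis x V xV.
have re : r%:num < r%:num + e / 8 by lra.
have [b] := rat_in_itvoo re; rewrite in_itv/= => /andP[rb be].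
have e42 : e / 4 < e / 2 by lra.
have [a] := rat_in_itvoo e42; rewrite in_itv/= => /andP[ea ae].
have b0 : 0 < ratr b :> R by apply: lt_trans rb.
pose c : cone M := center (Some (f U, b)).
set y := xget point U.
have [rho rhoE] : exists rho : {posnum R}, rho%:num = ratr b by exists (PosNum b0).
have cE : c = Some (y, rho) by rewrite /c /= BmE// -rhoE cone_ptE.
rewrite -rhoE in rb be.
have Uy : U y by exact: xgetPex (ex_intro _ x Ux).
have yr : dC (Some (y, r) : cone M) c < e / 8.
  by rewrite cE dC_same_base distrC ger0_norm ?subr_ge0 ?(ltW rb)// ltrBlDl.
have ry : dC c (Some (y, r) : cone M) < e / 8.
  by rewrite cE dC_same_base ger0_norm ?subr_ge0 ?(ltW rb)// ltrBlDl.
have xy : dC (Some (x, r) : cone M) (Some (y, r)) < e / 8.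
  by apply: dV; apply: UV.
have yx : dC (Some (y, r) : cone M) (Some (x, r)) < e / 8.
  by apply: dV; apply: UV.
exists (pickle ((Some (f U, b), a) : option (nat * rat) * rat));
  rewrite /N pickleK -/c /=.
  by have := dC_triangle (Some (y, r)) c (Some (x, r)); lra.
move=> q /= cq; have := dC_triangle c (Some (x, r)) q.
by have := dC_triangle (Some (y, r)) (Some (x, r)) c; lra.
Qed.

(* The Borel sets of C * C are generated by countably many rectangles. *)
Lemma measurable_cone_pair d (T : measurableType d) (f g : T -> borelC M) :
  measurable_fun setT f -> measurable_fun setT g ->
  measurable_fun setT ((fun t => (f t, g t)) : T -> borelCC M).
Proof.
move=> mf mg; apply: measurable_fun_gen => U oU.
have [N [oN Nbase]] := countable_dC_base.
pose K := [set kl : nat * nat | N kl.1 `*` N kl.2 `<=` U].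
pose F (kl : nat * nat) :=
  if `[< K kl >] then f @^-1` N kl.1 `&` g @^-1` N kl.2 else set0.
rewrite [X in measurable X](_ : _ = \bigcup_kl F kl).
  apply: countable_bigcupT_measurable => // kl; rewrite /F; case: ifPn => // _.
  by apply: measurableI; rewrite -[X in measurable X]setTI;
    [apply: mf|apply: mg] => //; exact: dC_open_measurable.
apply/seteqP; split => [t /= /oU[e e0 eU]|t [kl _]]; last first.
  by rewrite /F; case: ifPn => // /asboolP h [ft gt]; exact: (h (f t, g t)).
have [k kf kU] := Nbase (f t) e e0; have [l lg lU] := Nbase (g t) e e0.
exists (k, l) => //; rewrite /F ifT//; apply/asboolP => -[p q] /= [Np Nq].
by apply: eU; [exact: kU|exact: lU].
Qed.

Lemma measurable_cone_fst : measurable_fun setT (fst : borelCC M -> borelC M).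
Proof.
apply: measurable_fun_gen => U oU; apply: dC2_open_measurable => z /= /oU[e e0 eU].
by exists e => // w zw _; exact: eU.
Qed.

Lemma measurable_cone_snd : measurable_fun setT (snd : borelCC M -> borelC M).
Proof.
apply: measurable_fun_gen => U oU; apply: dC2_open_measurable => z /= /oU[e e0 eU].
by exists e => // w _; exact: eU.
Qed.

End cone_borel.

(** * Image measures and integration under a measurable isomorphism *)

Section integral_iso.
Context d d' (T1 : measurableType d) (T2 : measurableType d') (R : realType).

(** The measure structure on [pushforward] depends on the proof that F is measurable; naming a
    measure m with the same values lets lemmas about measures apply after a rewriting. *)
Lemma pushforward_is_measure (mu : {measure set T1 -> \bar R}) (F : T1 -> T2) :
  measurable_fun setT F ->
  exists m : {measure set T2 -> \bar R}, m = pushforward mu F :> (_ -> _).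
Proof.
by move=> mF; exists (measure_function_pushforward__canonical__measure_function_Measure mu mF).
Qed.

(** The inequality for [pushforward] is used for F and then for its inverse G, which gives equality
    without measurability of f. *)
Lemma lower_integral_pushforward_iso (mu : {measure set T1 -> \bar R})
    (F : T1 -> T2) (G : T2 -> T1) (f : T2 -> \bar R) :
  measurable_fun setT F -> measurable_fun setT G -> cancel F G -> cancel G F ->
  (forall y, 0 <= f y)%E ->
  (\int[pushforward mu F]_y f y = \int[mu]_x f (F x))%E.
Proof.
move=> mF mG FK GK f0; apply/eqP; rewrite eq_le lower_integral_pushforward//=.
have [m mE] := pushforward_is_measure mu mF.
have muE : mu = pushforward m G :> (_ -> _).
  apply/funext => A; rewrite mE /pushforward; congr (mu _).
  by apply/seteqP; split => x /=; rewrite FK.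
rewrite -mE [leLHS](_ : _ = \int[pushforward m G]_x f (F x))%E; last by rewrite -muE.
apply: le_trans (lower_integral_pushforward _ mG _) _ => //.
by under eq_integral do rewrite GK.
Qed.

End integral_iso.

(** * Dilations of the cone and scaling of the measure *)

Section dilation.
Context {R : realType} {n : nat} {M : riemannian_manifold R n}.
Implicit Types (x y z : M) (p q w : cone M) (k r s : {posnum R}).

Definition dil k p : cone M :=
  if p is Some (x, r) then Some (x, (k%:num * r%:num)%:pos) else None.

Lemma dilK k : cancel (dil k) (dil (k%:num^-1)%:pos).
Proof.
by case=> [[x r]|]//=; congr (Some (x, _)); apply/val_inj; rewrite /= mulKf.
Qed.

Lemma dilVK k : cancel (dil (k%:num^-1)%:pos) (dil k).
Proof.
by case=> [[x r]|]//=; congr (Some (x, _)); apply/val_inj; rewrite /= mulVKf.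
Qed.

Lemma radius_dil k p : radius (dil k p) = k%:num * radius p.
Proof. by case: p => [[x r]|]//=; rewrite mulr0. Qed.

Lemma dC_dil k p q : dC (dil k p) (dil k q) = k%:num * dC p q.
Proof.
have k0 : 0 <= k%:num by [].
apply/eqP; rewrite -(@eqrXn2 _ 2%N) ?mulr_ge0 ?dC_ge0// exprMn !sqr_dC !radius_dil.
have -> : angle (dil k p) (dil k q) = angle p q by case: p q => [[x r]|] [[y s]|].
by apply/eqP; ring.
Qed.

Lemma dil_cone_pt k x (r : R) : 0 <= r ->
  dil k (cone_pt x r) = cone_pt x (k%:num * r).
Proof.
rewrite le_eqVlt => /predU1P[<-|r0].
  by rewrite mulr0 !cone_pt0.
have kr0 : 0 < k%:num * r by rewrite mulr_gt0.
by rewrite !cone_pt_pos /=; congr (Some (x, _)); apply/val_inj.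
Qed.

Lemma measurable_dil k : measurable_fun setT (dil k : borelC M -> borelC M).
Proof.
apply: measurable_fun_gen => U oU; apply: dC_open_measurable => p /= /oU[e e0 eU].
exists (k%:num^-1 * e); first by rewrite mulr_gt0.
by move=> q pq; apply: eU; rewrite dC_dil -ltr_pdivlMl.
Qed.

Definition dil2 k (z : cone M * cone M) := (dil k z.1, dil k z.2).

Lemma measurable_dil2 k : measurable_fun setT (dil2 k : borelCC M -> borelCC M).
Proof.
apply: measurable_fun_gen => U oU; apply: dC2_open_measurable => p /= /oU[e e0 eU].
exists (k%:num^-1 * e); first by rewrite mulr_gt0.
by move=> q pq1 pq2; apply: eU; rewrite dC_dil -ltr_pdivlMl.
Qed.

Lemma cylinder_dil k (A : set M) p : cylinder A (dil k p) <-> cylinder A p.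
Proof.
have h k' q : cylinder A q -> cylinder A (dil k' q).
  move=> [[x r] [/= Ax r0] <-]; exists (x, k'%:num * r).
    by split => //=; rewrite mulr_ge0.
  by rewrite /= dil_cone_pt.
by split => [/(h (k%:num^-1)%:pos)|/h//]; rewrite dilK.
Qed.

(** The field (grad phi, 2 r phi) is homogeneous in r: the ratio inside the arctangent is unchanged,
    hence so is the base point, and the new radius is multiplied by k. *)
Lemma expC_dil k (phi : h1pair M) p :
  expC (dil k p) (cone_field phi (dil k p)) = dil k (expC p (cone_field phi p)).
Proof.
case: p => [[x r]|]//=; rewrite dil_cone_pt ?sqrtr_ge0//.
congr cone_pt.
  case: eqP => // _; congr expM; rewrite /base_shift; congr ((atan _ / _) *: _).
  rewrite (_ : k%:num * r%:num + _ = k%:num * (r%:num + 2 * r%:num * h1val phi x)); last by ring.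
  by rewrite -(mulrA k%:num) -mulf_div divff// mul1r.
rewrite [X in Num.sqrt X = _](_ : _ = k%:num ^+ 2 * ((r%:num +
  2 * r%:num * h1val phi x) ^+ 2 + r%:num ^+ 2 * @tnorm _ _ M x (h1grad phi x) ^+ 2)).
  by rewrite sqrtrM ?sqr_ge0// sqrtr_sqr ger0_norm.
by ring.
Qed.

Lemma Pr_dil k (nu : {measure set (borelC M) -> \bar R}) (A : set M) :
  Pr (pushforward nu (dil k : borelC M -> borelC M)) A = ((k%:num ^+ 2)%:E * Pr nu A)%E.
Proof.
have f0 (B : set (cone M)) p : (0 <= ((fun p => (radius p ^+ 2)%:E) \_ B) p)%E.
  by rewrite /patch; case: ifP => // _; rewrite lee_fin sqr_ge0.
have [m mE] := pushforward_is_measure nu (measurable_dil k).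
rewrite /Pr -mE [LHS]integral_mkcond [in RHS]integral_mkcond mE.
rewrite (lower_integral_pushforward_iso nu (measurable_dil k)
  (measurable_dil (k%:num^-1)%:pos) (dilK k) (dilVK k))//.
rewrite -lower_integralZl ?exprn_gt0//; apply: eq_integral => p _.
rewrite /patch; have [pA|pA] := pselect (cylinder A p).
  by rewrite !mem_set//; [rewrite radius_dil exprMn|exact/cylinder_dil].
by rewrite !memNset ?mule0// => /cylinder_dil.
Qed.

Lemma HK_plan_dil k (mu0 mu1 mu0' mu1' : set M -> \bar R)
    (q : {measure set (borelCC M) -> \bar R}) :
  (forall A, mu0' A = (k%:num ^+ 2)%:E * mu0 A)%E ->
  (forall A, mu1' A = (k%:num ^+ 2)%:E * mu1 A)%E ->
  HK_plan mu0 mu1 q -> exists2 q' : {measure set (borelCC M) -> \bar R},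
    HK_plan mu0' mu1' q' &
    (\int[q']_z (dC z.1 z.2 ^+ 2)%:E =
     (k%:num ^+ 2)%:E * \int[q]_z (dC z.1 z.2 ^+ 2)%:E)%E.
Proof.
move=> e0 e1 [qM2 q0 q1].
have [q' q'E] := pushforward_is_measure q (measurable_dil2 k).
have d2K : cancel (dil2 k) (dil2 (k%:num^-1)%:pos) by move=> [? ?]; rewrite /dil2/= !dilK.
have d2VK : cancel (dil2 (k%:num^-1)%:pos) (dil2 k) by move=> [? ?]; rewrite /dil2/= !dilVK.
have iE (f : cone M * cone M -> \bar R) : (forall u : cone M * cone M, 0 <= f u)%E ->
    (\int[q']_u f u = \int[q]_u f (dil2 k u))%E.
  move=> f0; rewrite q'E; 
  exact: (lower_integral_pushforward_iso q (measurable_dil2 k)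
    (measurable_dil2 (k%:num^-1)%:pos) d2K d2VK f0).
have dnn (z : cone M * cone M) : (0 <= (1 + dC z.1 None ^+ 2 + dC z.2 None ^+ 2)%:E)%E.
  by rewrite lee_fin !addr_ge0 ?sqr_ge0.
exists q'; last first.
  rewrite iE => [|z]; last by rewrite lee_fin sqr_ge0.
  rewrite -lower_integralZl ?exprn_gt0// => [|z]; last by rewrite lee_fin sqr_ge0.
  by apply: eq_integral => z _; rewrite /dil2/= dC_dil exprMn EFinM.
split.
- rewrite /in_M2CC iE//.
  (* For x, y >= 0, 1 + k^2 x + k^2 y <= (1 + k^2) (1 + x + y). *)
  pose K := 1 + k%:num ^+ 2.
  have K0 : 0 < K by rewrite ltr_pwDl// sqr_ge0.
  apply: (@le_lt_trans _ _ (K%:E * \int[q]_z (1 + dC z.1 None ^+ 2 + dC z.2 None ^+ 2)%:E)%E).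
    rewrite -lower_integralZl//; apply: le_lower_integral => // z.
    rewrite /dil2/= -![dC (dil _ _) None]/(dC (dil k _) (dil k None)) !dC_dil.
    rewrite -EFinM lee_fin /K.
    have := sqr_ge0 (dC z.1 None); have := sqr_ge0 (dC z.2 None); have := sqr_ge0 k%:num.
    by rewrite !exprMn; nra.
  by rewrite lte_mul_pinfty// lee_fin ltW.
- move=> A mA; rewrite q'E e0 -q0//.
  have [q1' q1E] := pushforward_is_measure q (@measurable_cone_fst _ _ M).
  by rewrite -q1E -Pr_dil q1E.
- move=> A mA; rewrite q'E e1 -q1//.
  have [q1' q1E] := pushforward_is_measure q (@measurable_cone_snd _ _ M).
  by rewrite -q1E -Pr_dil q1E.
Qed.

Definition HK_inf (mu0 mu1 : set M -> \bar R) : \bar R :=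
  ereal_inf [set (\int[q]_z (dC z.1 z.2 ^+ 2)%:E)%E | q in HK_plan mu0 mu1].

Lemma HK_inf_ge0 mu0 mu1 : (0 <= HK_inf mu0 mu1)%E.
Proof.
apply: le_ereal_inf_tmp => _ [q _ <-].
by apply: integral_ge0 => z _; rewrite lee_fin sqr_ge0.
Qed.

Lemma sqr_HK mu0 mu1 : HK mu0 mu1 ^+ 2 = fine (HK_inf mu0 mu1).
Proof. by rewrite sqr_sqrtr// fine_ge0// HK_inf_ge0. Qed.

Lemma HK_inf_dil_le k (mu0 mu1 mu0' mu1' : set M -> \bar R) :
  (forall A, mu0' A = (k%:num ^+ 2)%:E * mu0 A)%E ->
  (forall A, mu1' A = (k%:num ^+ 2)%:E * mu1 A)%E ->
  (HK_inf mu0' mu1' <= (k%:num ^+ 2)%:E * HK_inf mu0 mu1)%E.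
Proof.
move=> e0 e1; rewrite -lee_pdivrMl ?exprn_gt0//.
apply: le_ereal_inf_tmp => _ [q qP <-]; rewrite lee_pdivrMl ?exprn_gt0//.
have [q' q'P <-] := HK_plan_dil e0 e1 qP.
by apply: ereal_inf_lbound; exists q'.
Qed.

(** Two inequalities, for k and for k^-1. An infimum over no plan at all is +oo and is covered
    too. *)
Lemma sqr_HK_dil k (mu0 mu1 mu0' mu1' : set M -> \bar R) :
  (forall A, mu0' A = (k%:num ^+ 2)%:E * mu0 A)%E ->
  (forall A, mu1' A = (k%:num ^+ 2)%:E * mu1 A)%E ->
  HK mu0' mu1' ^+ 2 = k%:num ^+ 2 * HK mu0 mu1 ^+ 2.
Proof.
move=> e0 e1; rewrite !sqr_HK -fine_pmulEl ?exprn_gt0//; congr fine.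
have inv (nu nu' : set M -> \bar R) : (forall A, nu' A = (k%:num ^+ 2)%:E * nu A)%E ->
    (forall A, nu A = (((k%:num^-1)%:pos)%:num ^+ 2)%:E * nu' A)%E.
  move=> e A; rewrite e muleA -EFinM -exprMn /= mulVf// expr1n mul1e//.
apply/eqP; rewrite eq_le HK_inf_dil_le//=.
have := HK_inf_dil_le (inv _ _ e0) (inv _ _ e1).
by rewrite /= exprVn lee_pdivlMl ?exprn_gt0.
Qed.

End dilation.

(** * The measure on the cone and its exponential fields under dilation *)

Section hat_measure.
Context {R : realType} {n : nat} {M : riemannian_manifold R n}.
Implicit Types (mu : {measure set (borelM M) -> \bar R}) (phi psi : h1pair M).

Lemma hat_is_measure mu (r : {posnum R}) : r%:num = r_of mu ->
  exists m : {measure set (borelC M) -> \bar R}, m = hat mu :> (_ -> _).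
Proof.
move=> rE; have [m0 m0E] := pushforward_is_measure mu (measurable_cone_pt r).
have r0 : 0 <= (r_of mu ^+ 2)^-1 by rewrite invr_ge0 sqr_ge0.
exists (mscale (NngNum r0) m0); apply/funext => B.
pose j : borelM M -> borelC M := fun x => cone_pt x r%:num.
transitivity (((r_of mu ^+ 2)^-1)%:E * pushforward mu j B)%E.
  by rewrite -m0E.
by rewrite /pushforward /j rE.
Qed.

Definition exp_fields mu phi := [set T : borelC M -> borelC M |
  measurable_fun setT T /\ {ae hat mu, forall p, T p = expC p (cone_field phi p)}].

Lemma measurable_exp_field mu phi : measurable_fun setT (exp_field mu phi).
Proof.
by rewrite /exp_field; case: xgetP => [T _ [mT _]//|_]; exact: measurable_cst.
Qed.

(* If exp^C of the field has no Borel version, [exp_field] is constantly the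
   vertex. *)
Lemma exp_fieldP mu phi : exp_fields mu phi (exp_field mu phi) \/
  exp_field mu phi = (fun=> None) /\ forall T, ~ exp_fields mu phi T.
Proof.
by rewrite /exp_field; case: xgetP => [T _ ST|nT]; [left|right].
Qed.

Section dilated.
Variables (mu mu' : {measure set (borelM M) -> \bar R}) (k : {posnum R}).
Hypothesis hat_dil :
  hat mu' = pushforward (hat mu) (dil k : borelC M -> borelC M).

Let k' := (k%:num^-1)%:pos.

Lemma hat_dilV : hat mu = pushforward (hat mu') (dil k' : borelC M -> borelC M).
Proof.
apply/funext => A; rewrite hat_dil /pushforward -comp_preimage.
by congr hat; apply/seteqP; split => p /=; rewrite dilK.
Qed.

Lemma exp_fields_dil phi (T : borelC M -> borelC M) : exp_fields mu phi T ->
  exp_fields mu' phi (dil k \o T \o dil k').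
Proof.
move=> [mT [A [mA A0 TA]]]; split.
  apply: measurableT_comp; last exact: measurable_dil.
  by apply: measurableT_comp => //; exact: measurable_dil.
exists (dil k' @^-1` A); split.
- rewrite -[X in measurable X]setTI; exact: (measurable_dil k').
- rewrite hat_dil /pushforward -comp_preimage -[RHS]A0; congr hat.
  by apply/seteqP; split => p /=; rewrite dilK.
move=> p /= np; apply: TA => /= Tp; apply: np.
by rewrite -[p in RHS](dilVK k) expC_dil -Tp.
Qed.

End dilated.

End hat_measure.

Section exp_dilated.
Context {R : realType} {n : nat} {M : riemannian_manifold R n}.
Implicit Types (phi psi : h1pair M).
Variables (mu mu' : {measure set (borelM M) -> \bar R}) (k : {posnum R}).
Hypothesis hat_dil :
  hat mu' = pushforward (hat mu) (dil k : borelC M -> borelC M).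
Variables m m' : {measure set (borelC M) -> \bar R}.
Hypotheses (mE : m = hat mu :> (_ -> _)) (m'E : m' = hat mu' :> (_ -> _)).

Let k' := (k%:num^-1)%:pos.

(** Conjugation by the dilation turns Borel versions for mu into Borel versions for mu', and back.
    So either both choices are versions, equal almost everywhere after conjugation, or neither
    exists and both are the vertex, which dilations fix. *)
Lemma exp_field_dil phi :
  {ae hat mu', forall p, exp_field mu' phi p = dil k (exp_field mu phi (dil k' p))}.
Proof.
have [ST|[E nT]] := exp_fieldP mu phi; have [ST'|[E' nT']] := exp_fieldP mu' phi.
- have [_ T'E] := ST'; have [_ TE] := exp_fields_dil hat_dil ST.
  rewrite -m'E in T'E TE *; apply: filterS2 T'E TE => p -> <- //.
- by case: (nT' _ (exp_fields_dil hat_dil ST)).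
- by case: (nT _ (exp_fields_dil (hat_dilV hat_dil) ST')).
- by rewrite -m'E; apply: aeW => p; rewrite E E'.
Qed.

Lemma exp_mu_dil phi (A : set M) :
  exp_mu mu' phi A = ((k%:num ^+ 2)%:E * exp_mu mu phi A)%E.
Proof.
have [nu nuE] := pushforward_is_measure m (measurable_exp_field mu phi).
rewrite /exp_mu -mE -nuE -Pr_dil.
have [nud nudE] := pushforward_is_measure nu (measurable_dil k).
have [nu' nu'E] := pushforward_is_measure m' (measurable_exp_field mu' phi).
(* Agreement of the two image measures on Borel sets determines the integral, even over the cylinder
   of an arbitrary A. *)
rewrite -nudE -m'E -nu'E /Pr; apply: eq_measure_integral => B mB _.
rewrite nu'E nudE /pushforward nuE /pushforward.
have mT' := measurable_exp_field mu' phi; have mT := measurable_exp_field mu phi.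
pose Y := (fun p => dil k (exp_field mu phi (dil k' p))) @^-1` B.
have mX : measurable (exp_field mu' phi @^-1` B : set (borelC M)).
  by rewrite -[X in measurable X]setTI; exact: mT'.
have mY : measurable (Y : set (borelC M)).
  rewrite -[X in measurable X]setTI /Y.
  have mk := measurableT_comp (measurable_dil k)
    (measurableT_comp mT (measurable_dil k')).
  exact: mk.
rewrite -[LHS](_ : m' Y = _).
  rewrite m'E hat_dil -mE /pushforward; congr (m _).
  by apply/seteqP; split => p; rewrite /Y /= dilK.
(* Measures are written as integrals of indicators, so that equality almost everywhere can be
   applied. *)
rewrite -(setIT Y) -[in RHS](setIT (_ @^-1` B)) -!integral_indic//.
apply: ae_eq_lower_integral => [p|p|]; try by rewrite lee_fin.
have := exp_field_dil phi; rewrite -m'E; apply: filterS => p pE.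
by rewrite !indicE; congr (_%:R%:E); congr nat_of_bool; apply/idP/idP;
  rewrite !inE /Y /= pE.
Qed.

Lemma lifted_cost_dil phi psi :
  lifted_cost mu' phi psi = k%:num ^+ 2 * lifted_cost mu phi psi.
Proof.
rewrite /lifted_cost -fine_pmulEl ?exprn_gt0//; congr fine.
rewrite -mE -lower_integralZl ?exprn_gt0// => [|p]; last by rewrite lee_fin sqr_ge0.
pose f p := ((dC (dil k (exp_field mu phi (dil k' p)))
  (dil k (exp_field mu psi (dil k' p)))) ^+ 2)%:E.
rewrite (_ : integral _ _ _ = \int[m']_p f p)%E; last first.
  rewrite -m'E; apply: ae_eq_lower_integral => [p|p|]; try by rewrite lee_fin sqr_ge0.
  have := exp_field_dil phi; have := exp_field_dil psi; rewrite -m'E => h1 h2.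
  by apply: filterS2 h1 h2 => p -> ->.
rewrite m'E hat_dil -mE (lower_integral_pushforward_iso m (measurable_dil k)
  (measurable_dil k') (dilK k) (dilVK k)); last first.
  by move=> p; rewrite lee_fin sqr_ge0.
by apply: eq_integral => p _; rewrite /f dC_dil !dilK exprMn EFinM.
Qed.

End exp_dilated.

Section scaled.
Context {R : realType} {n : nat} {M : riemannian_manifold R n}.
Implicit Types (mu : {measure set (borelM M) -> \bar R}) (phi psi : h1pair M).

Lemma r_of_gt0 mu : (mu setT < +oo)%E -> mu setT != 0%E -> 0 < r_of mu.
Proof.
move=> muT mu0; rewrite sqrtr_gt0 fine_gt0// muT andbT lt0e mu0.
exact: measure_ge0.
Qed.

Lemma r_of_mscale mu (k : {posnum R}) (a : {nonneg R}) :
  k%:num ^+ 2 = a%:num -> r_of (mscale a mu) = k%:num * r_of mu.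
Proof.
move=> ka; have a0 : 0 < a%:num by rewrite -ka exprn_gt0.
rewrite /r_of /mscale fine_pmulEl// -ka.
by rewrite sqrtrM ?sqr_ge0// sqrtr_sqr ger0_norm.
Qed.

(** The factor a of the measure cancels against k^2 = a in the squared radius of the normalization;
    only the radius of the slice changes. *)
Lemma hat_mscale mu (k : {posnum R}) (a : {nonneg R}) :
  k%:num ^+ 2 = a%:num ->
  hat (mscale a mu) = pushforward (hat mu) (dil k : borelC M -> borelC M).
Proof.
move=> ka; apply/funext => B.
rewrite /hat (r_of_mscale mu ka) /pushforward /mscale /=.
rewrite muleA -EFinM -ka exprMn invfM mulrAC mulVf ?mul1r ?gt_eqF ?exprn_gt0//.
congr (_ * mu _)%E; apply/seteqP; split => x /=; rewrite dil_cone_pt//.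
  by rewrite sqrtr_ge0.
by rewrite sqrtr_ge0.
Qed.

Lemma h1inner_mscale mu (a : {nonneg R}) phi psi : 0 < a%:num ->
  h1inner (mscale a mu) phi psi = a%:num * h1inner mu phi psi.
Proof. by move=> a0; rewrite /h1inner Rintegral_mscale_pos. Qed.

Lemma h1inner_ge0 mu phi : 0 <= h1inner mu phi phi.
Proof.
apply: Rintegral_ge0 => x _; rewrite /h1density addr_ge0 ?tinner_ge0//.
by rewrite -mulrA mulr_ge0// -expr2 sqr_ge0.
Qed.

Lemma sqr_h1norm mu phi : h1norm mu phi ^+ 2 = h1inner mu phi phi.
Proof. by rewrite sqr_sqrtr// h1inner_ge0. Qed.

Lemma Lambda_mscale mu (a : {nonneg R}) phi psi : 0 < a%:num ->
  Lambda (mscale a mu) phi psi = a%:num ^+ 2 * Lambda mu phi psi.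
Proof. by move=> a0; rewrite /Lambda !sqr_h1norm !h1inner_mscale//; ring. Qed.

Lemma h1scaleM (a b : R) phi : h1scale a (h1scale b phi) = h1scale (a * b) phi.
Proof.
by congr pair; apply/funext => x; rewrite /h1val /h1grad /= ?mulrA ?scalerA.
Qed.

Lemma h1inner_scale mu (a b : R) phi psi : 0 < a -> 0 < b ->
  h1inner mu (h1scale a phi) (h1scale b psi) = a * b * h1inner mu phi psi.
Proof.
move=> a0 b0; rewrite /h1inner -Rintegral_pmulEl ?mulr_gt0//.
congr Rintegral; apply/funext => x; rewrite /h1density /h1val /h1grad /= /tinner.
rewrite linearZ/= -!scalemxAl -scalemxAr !mxE /h1val.
by ring.
Qed.

Lemma Lambda_scale mu (a b : R) phi psi : 0 < a -> 0 < b ->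
  Lambda mu (h1scale a phi) (h1scale b psi) = a ^+ 2 * b ^+ 2 * Lambda mu phi psi.
Proof. by move=> a0 b0; rewrite /Lambda !sqr_h1norm !h1inner_scale//; ring. Qed.

End scaled.

(** * The competitor for HK given by the two exponential fields *)

Section energy.
Context {R : realType} {n : nat} {M : riemannian_manifold R n}.
Implicit Types (mu : {measure set (borelM M) -> \bar R}) (phi psi : h1pair M).

Lemma integral_hat_le mu (r : {posnum R}) (f : borelC M -> \bar R) :
  r%:num = r_of mu -> (forall p, 0 <= f p)%E ->
  (\int[hat mu]_p f p <=
   ((r%:num ^+ 2)^-1)%:E * \int[mu]_x f (cone_pt x r%:num))%E.
Proof.
move=> rE f0; have [m0 m0E] := pushforward_is_measure mu (measurable_cone_pt r).
have c0 : 0 <= (r%:num ^+ 2)^-1 by [].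
rewrite (_ : hat mu = mscale (NngNum c0) m0); last first.
  pose j : borelM M -> borelC M := fun x => cone_pt x r%:num.
  apply/funext => B; transitivity (((r%:num ^+ 2)^-1)%:E * pushforward mu j B)%E.
    by rewrite /pushforward /j rE.
  by rewrite -m0E.
rewrite lower_integral_mscale//= lee_pmul2l ?lte_fin ?invr_gt0 ?exprn_gt0//.
rewrite m0E; apply: lower_integral_pushforward => //.
exact: measurable_cone_pt.
Qed.

Lemma ae_hat mu (r : {posnum R}) (P : cone M -> Prop) : r%:num = r_of mu ->
  {ae hat mu, forall p, P p} -> {ae mu, forall x, P (cone_pt x r%:num)}.
Proof.
move=> rE [A [mA A0 PA]]; exists ((fun x => cone_pt x r%:num) @^-1` A); split.
- by rewrite -[X in measurable X]setTI; exact: (measurable_cone_pt r).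
- move: A0; rewrite /hat -rE => /eqP.
  by rewrite mule_eq0 eqe gt_eqF ?invr_gt0 ?exprn_gt0//= => /eqP.
by move=> x /= nP; exact: PA.
Qed.

(** By the parallelogram identity, the difference of the two sides is |v - w|^2. *)
Lemma tinnerD_le (x : M) (v w : 'rV[R]_n) :
  tinner x (v + w) (v + w) <= 2 * tinner x v v + 2 * tinner x w w.
Proof.
rewrite -subr_ge0 (_ : _ - _ = tinner x (v - w) (v - w)) ?tinner_ge0//.
rewrite /tinner !linearD !linearN /= !(mulmxDl, mulmxDr, mulmxN, mulNmx).
by rewrite !mxE; ring.
Qed.

Lemma h1density_ge0 phi x : 0 <= h1density phi phi x.
Proof. by rewrite addr_ge0 ?tinner_ge0// -mulrA mulr_ge0// -expr2 sqr_ge0. Qed.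

(* The squared radius of exp^C (s phi) is r^2 ((1 + 2 s phi)^2 + s^2 |grad phi|^2)
   almost everywhere. As [grad phi] is not known to be measurable, the bound is
   proved for the left-hand side, which is: it is at most a + b d with d the
   density of phi - eta_k, whose lower integral is finite. *)
Lemma exp_field_radius_finite (mu : {finite_measure set (borelM M) -> \bar R})
    (r : {posnum R}) phi (s : R) : r%:num = r_of mu -> in_H1 mu phi ->
  (\int[hat mu]_p (radius (exp_field mu (h1scale s phi) p) ^+ 2)%:E < +oo)%E.
Proof.
move=> rE [mphi _ [eta eta_smooth eta_cvg]].
have [[mT TE]|[-> _]] := exp_fieldP mu (h1scale s phi); last first.
  have [m <-] := hat_is_measure rE.
  by under eq_integral do rewrite expr0n; rewrite integral0.
set T := exp_field _ _ in mT TE *.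
pose d k x := h1density (h1sub phi (smooth_pair (eta k)))
                        (h1sub phi (smooth_pair (eta k))) x.
have [k dk] : exists k, (\int[mu]_x (d k x)%:E < 1)%E.
  have : nbhs (0%E : \bar R) [set x | (x < 1)%E].
    by apply: open_nbhs_nbhs; split; [exact: open_ereal_lt_ereal|rewrite /= lte01].
  by move=> /eta_cvg h; have [k] := @filter_ex _ \oo _ _ h; exists k.
have [B B0 etaB] := Cc_infty_bounded (eta_smooth k).
pose g x := radius (T (cone_pt x r%:num)) ^+ 2.
have mg : measurable_fun (setT : set (borelM M)) g.
  apply: measurable_funX.
  exact: (measurableT_comp measurable_radius
           (measurableT_comp mT (measurable_cone_pt r))).
(* From (1 + 2 s f)^2 <= 2 + 8 s^2 f^2, f^2 <= 2 (f - eta)^2 + 2 eta^2 and |grad phi|^2 <= 2 |grad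
   phi - grad eta|^2 + 2 |grad eta|^2, with eta = eta_k. The summand 1 in b keeps it positive at s =
   0, for the division in G. *)
pose a := 2 * r%:num ^+ 2 + 4 * r%:num ^+ 2 * s ^+ 2 * B.
pose b := 4 * r%:num ^+ 2 * s ^+ 2 + 1.
have rs0 : 0 <= r%:num ^+ 2 * s ^+ 2 by rewrite mulr_ge0 ?sqr_ge0.
have b0 : 0 < b by rewrite /b; lra.
have a0 : 0 <= a.
  by have := mulr_ge0 rs0 B0; have := sqr_ge0 r%:num; rewrite /a; lra.
have gle : {ae mu, forall x, g x <= a + b * d k x}.
  apply: (@filterS _ _ (ae_filter_ringOfSetsType mu) _ _ _ (ae_hat rE TE)) => x.
  rewrite /g => ->; rewrite cone_ptE /=.
  rewrite radius_cone_pt ?sqrtr_ge0// sqr_sqrtr; last first.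
    by apply: addr_ge0; [exact: sqr_ge0|apply: mulr_ge0; exact: sqr_ge0].
  rewrite /tnorm sqr_sqrtr ?tinner_ge0//.
  have := etaB x; rewrite /d /h1density /h1sub /h1val /h1grad /=.
  have -> : tinner x (s *: phi.2 x) (s *: phi.2 x) = s ^+ 2 * tinner x (phi.2 x) (phi.2 x).
    by rewrite /tinner linearZ/= -!scalemxAl -scalemxAr !mxE; ring.
  have := tinnerD_le x (phi.2 x - grad (eta k) x) (grad (eta k) x).
  rewrite subrK.
  have := tinner_ge0 x (grad (eta k) x).
  have := tinner_ge0 x (phi.2 x - grad (eta k) x).
  rewrite /a /b; move: (tinner _ _ _) (tinner _ _ _) (tinner _ _ _) => P Q X.
  move: (phi.1 x) (eta k x) => f e P0 Q0 XPQ QB.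
  have rs := ler_wpM2l rs0.
  have := rs _ _ P0; have := rs _ _ Q0; have := rs _ _ XPQ; have := rs _ _ QB.
  have := rs _ _ (sqr_ge0 (f - 2 * e)).
  have := mulr_ge0 (sqr_ge0 r%:num) (sqr_ge0 (1 - 2 * s * f)).
  have := sqr_ge0 (f - e).
  by rewrite !expr2; lra.
(* A measurable substitute for [d k]: almost everywhere at most [d k], and with g <= a + b G
   everywhere, so that additivity of the integral applies. *)
pose G x := Num.max ((g x - a) / b) 0.
have mG : measurable_fun (setT : set (borelM M)) G.
  apply: measurable_maxr => //; apply: measurable_funM => //.
  exact: measurable_funB.
have G0 x : 0 <= G x by rewrite le_max lexx orbT.
have intG : (\int[mu]_x (G x)%:E < +oo)%E.
  apply: (@le_lt_trans _ _ (\int[mu]_x (d k x)%:E)%E); last first.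
    by rewrite (lt_trans dk)// ltry.
  apply: ae_le_lower_integral => [x|x|]; rewrite ?lee_fin ?h1density_ge0//.
  apply: (@filterS _ _ (ae_filter_ringOfSetsType mu) _ _ _ gle) => x gx.
  rewrite lee_fin ge_max h1density_ge0 andbT.
  by rewrite ler_pdivrMr//; lra.
apply: (le_lt_trans (integral_hat_le rE _)) => [p|]; first by rewrite lee_fin sqr_ge0.
rewrite lte_mul_pinfty ?lee_fin//.
apply: (@le_lt_trans _ _ (\int[mu]_x (a%:E + b%:E * (G x)%:E))%E).
  apply: le_lower_integral => x; first by rewrite lee_fin sqr_ge0.
  rewrite -EFinM -EFinD lee_fin -/(g x) /G.
  have : (g x - a) / b <= Num.max ((g x - a) / b) 0 by rewrite le_max lexx.
  by rewrite ler_pdivrMr//; lra.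
have mbG : measurable_fun (setT : set (borelM M)) (fun x => (b%:E * (G x)%:E)%E).
  by under eq_fun do rewrite -EFinM; apply/measurable_EFinP; exact: measurable_funM.
rewrite (@ge0_integralD _ _ _ mu _ measurableT (cst a%:E) _ _ _ _ mbG)//; last first.
  by move=> x _; rewrite -EFinM lee_fin mulr_ge0// ltW.
rewrite integral_cst// lower_integralZl//.
apply: lte_add_pinfty.
  by rewrite lte_mul_pinfty ?lee_fin// fin_num_fun_lty//; exact: fin_num_measure.
by rewrite lte_mul_pinfty ?lee_fin// ltW.
Qed.


End energy.

Section twisted.
Context {R : realType} {n : nat} {M : riemannian_manifold R n}.
Implicit Types (mu : {measure set (borelM M) -> \bar R}) (phi psi : h1pair M).

Lemma dCo (p : cone M) : dC p None = radius p.
Proof.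
apply/eqP; rewrite eq_le; apply/andP; split.
  by have := dC_le_add p None; rewrite /= addr0.
by have := dist_radius_le_dC p None; rewrite /= subr0 ger0_norm// radius_ge0.
Qed.

(** The second moments serve twice: they put the competitor among the plans and, since dC is at most
    the sum of the radii, they make the cost finite, so that [fine] is monotone here. *)
Lemma sqr_HK_le_lifted_cost (mu : {finite_measure set (borelM M) -> \bar R})
    (r : {posnum R}) phi psi : r%:num = r_of mu ->
  (\int[hat mu]_p (radius (exp_field mu phi p) ^+ 2)%:E < +oo)%E ->
  (\int[hat mu]_p (radius (exp_field mu psi p) ^+ 2)%:E < +oo)%E ->
  HK (exp_mu mu phi) (exp_mu mu psi) ^+ 2 <= lifted_cost mu phi psi.
Proof.
move=> rE; have [m mE] := hat_is_measure rE.
rewrite /lifted_cost /exp_mu -mE.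
have := measurable_exp_field mu phi; have := measurable_exp_field mu psi.
move: (exp_field mu phi) (exp_field mu psi) => S T mT mS fS fT.
have [q qE] := pushforward_is_measure m (measurable_cone_pair mS mT).
have muT : (mu setT < +oo)%E.
  by rewrite fin_num_fun_lty//; exact: fin_num_measure.
have m1 : (m setT < +oo)%E.
  by rewrite mE /hat lte_mul_pinfty ?lee_fin// invr_ge0 sqr_ge0.
have mr2 (F : borelC M -> borelC M) : measurable_fun setT F ->
    measurable_fun setT (fun p => (radius (F p) ^+ 2)%:E).
  move=> mF; apply/measurable_EFinP; apply: measurable_funX.
  exact: measurableT_comp measurable_radius mF.
pose u (F : borelC M -> borelC M) p := (2%:E * (radius (F p) ^+ 2)%:E)%E.
have uE F p : u F p = (2 * radius (F p) ^+ 2)%:E by [].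
have u0 F p : (0 <= u F p)%E by rewrite uE lee_fin mulr_ge0// sqr_ge0.
have mu2 (F : borelC M -> borelC M) : measurable_fun setT F ->
    measurable_fun setT (u F).
  by move=> mF; apply: measurable_funeM; exact: mr2.
have u_fin (F : borelC M -> borelC M) : (\int[m]_p (radius (F p) ^+ 2)%:E < +oo)%E ->
    (\int[m]_p u F p < +oo)%E.
  move=> fF; rewrite lower_integralZl// => [|p]; last by rewrite lee_fin sqr_ge0.
  by rewrite lte_mul_pinfty.
have uD_fin : (\int[m]_p (u S p + u T p) < +oo)%E.
  rewrite ge0_integralD//; [|exact: mu2|exact: mu2].
  by apply: lte_add_pinfty; exact: u_fin.
have sum_fin : (\int[m]_p (1 + (u S p + u T p)) < +oo)%E.
  rewrite (@ge0_integralD _ _ _ m _ measurableT (cst 1%E))//; last 2 first.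
  - by move=> p _; exact: adde_ge0.
  - by apply: emeasurable_funD; exact: mu2.
  by apply: lte_add_pinfty => //; rewrite integral_cst// mul1e.
have qP : HK_plan (Pr (pushforward m S)) (Pr (pushforward m T)) q.
  split.
  - rewrite /in_M2CC qE.
    apply: le_lt_trans (lower_integral_pushforward m (measurable_cone_pair mS mT) _) _.
      by move=> w; rewrite lee_fin !addr_ge0 ?sqr_ge0.
    apply: le_lt_trans sum_fin.
    apply: le_lower_integral => p /=; first by rewrite lee_fin !addr_ge0 ?sqr_ge0.
    rewrite !uE -!EFinD lee_fin !dCo.
    move: (radius (S p)) (radius (T p)) => x y.
    by have := sqr_ge0 x; have := sqr_ge0 y; lra.
  - by move=> A _; rewrite qE.
  - by move=> A _; rewrite qE.
have cost_le : (HK_inf (Pr (pushforward m S)) (Pr (pushforward m T)) <=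
    \int[m]_p (dC (S p) (T p) ^+ 2)%:E)%E.
  apply: (@le_trans _ _ (\int[q]_z (dC z.1 z.2 ^+ 2)%:E)%E).
    by apply: ereal_inf_lbound; exists q.
  rewrite qE.
  apply: le_trans (lower_integral_pushforward m (measurable_cone_pair mS mT) _) _ => //.
  by move=> w; rewrite lee_fin sqr_ge0.
have cost_fin : (\int[m]_p (dC (S p) (T p) ^+ 2)%:E < +oo)%E.
  apply: le_lt_trans uD_fin; apply: le_lower_integral => p.
    by rewrite lee_fin sqr_ge0.
  rewrite !uE -EFinD lee_fin.
  apply: (@le_trans _ _ ((radius (S p) + radius (T p)) ^+ 2)).
    by rewrite ler_sqr ?nnegrE ?dC_ge0 ?addr_ge0 ?radius_ge0// dC_le_add.
  move: (radius (S p)) (radius (T p)) => x y.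
  by have := sqr_ge0 (x - y); rewrite !expr2; lra.
rewrite sqr_HK; apply: fine_le => //.
- by rewrite ge0_fin_numE ?HK_inf_ge0//; exact: le_lt_trans cost_le _.
- by rewrite ge0_fin_numE// integral_ge0// => p _; rewrite lee_fin sqr_ge0.
Qed.


End twisted.

(** * Limits along comparable sequences *)

Section limits.
Context {R : realType}.
Implicit Types F G : R -> R -> R.

Lemma eq_is_limstar F G (L : R) : (forall s t, F s t = G s t) ->
  is_limstar F L -> is_limstar G L.
Proof.
by move=> FG; rewrite (_ : F = G)//; apply/funext => s; apply/funext => t.
Qed.

Lemma is_limstarD F G (L L' : R) : is_limstar F L -> is_limstar G L' ->
  is_limstar (fun s t => F s t + G s t) (L + L').
Proof.
by move=> FL GL s t s0 t0 cs ct K; apply: cvgD; [exact: FL|exact: GL].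
Qed.

Lemma is_limstarZ F (c L : R) : is_limstar F L ->
  is_limstar (fun s t => c * F s t) (c * L).
Proof. by move=> FL s t s0 t0 cs ct K; apply: cvgMr; exact: FL. Qed.

Lemma is_limstarZ_iff F (c L : R) : c != 0 ->
  is_limstar (fun s t => c * F s t) (c * L) <-> is_limstar F L.
Proof.
move=> c0; split => [h|]; last exact: is_limstarZ.
have := @is_limstarZ _ c^-1 _ h; rewrite mulKf//.
by apply: eq_is_limstar => s t; rewrite mulKf.
Qed.

Lemma is_limstar_rescale F (a b L : R) : 0 < a -> 0 < b -> is_limstar F L ->
  is_limstar (fun s t => F (s * a) (t * b)) L.
Proof.
move=> a0 b0 FL s t s0 t0 cs ct [K stK].
have lim0 (u : nat -> R) (c : R) : u @ \oo --> (0 : R) ->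
    (fun j => u j * c) @ \oo --> (0 : R).
  by move=> cu; rewrite -(mul0r c); apply: cvgMl.
apply: (FL (fun j => s j * a) (fun j => t j * b)).
- by move=> j; rewrite mulr_gt0.
- by move=> j; rewrite mulr_gt0.
- exact: lim0.
- exact: lim0.
(* Expanding (s/t + t/s) (a/b + b/a) gives the two required ratios and two positive terms. *)
exists (K * (a / b + b / a)) => j.
have x0 : 0 < s j / t j by rewrite divr_gt0.
have y0 : 0 < t j / s j by rewrite divr_gt0.
have ab0 : 0 < a / b by rewrite divr_gt0.
have ba0 : 0 < b / a by rewrite divr_gt0.
rewrite -!mulf_div.
apply: (@le_trans _ _ ((s j / t j + t j / s j) * (a / b + b / a))).
  have := mulr_gt0 x0 ba0; have := mulr_gt0 y0 ab0; lra.
by rewrite ler_wpM2r// ?stK// addr_ge0// ltW.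
Qed.

(** One admissible pair of sequences is enough: s_j = t_j = 1 / (j + 1). *)
Lemma is_limstar_ge0 F (L : R) : (forall s t, 0 < s -> 0 < t -> 0 <= F s t) ->
  is_limstar F L -> 0 <= L.
Proof.
move=> F0 FL; have c : F (harmonic j) (harmonic j) @[j --> \oo] --> L.
  apply: FL; [exact: harmonic_gt0|exact: harmonic_gt0|exact: cvg_harmonic|exact: cvg_harmonic|].
  by exists 2 => j; rewrite divff ?gt_eqF ?harmonic_gt0.
rewrite -(cvg_lim _ c)//; apply: limr_ge; first by apply: cvgP c.
by apply: nearW => j; apply: F0; exact: harmonic_gt0.
Qed.

End limits.

(** * Sectional curvature *)

Section sectional_curvature.
Context {R : realType} {n : nat} {M : riemannian_manifold R n}.
Implicit Types (mu : {measure set (borelM M) -> \bar R}) (phi psi : h1pair M).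

Lemma h1scale1 phi : h1scale 1 phi = phi.
Proof.
by case: phi => f v; congr pair; apply/funext => x; rewrite /= ?mul1r ?scale1r.
Qed.

Lemma is_Sec_scale mu (a b L : R) phi psi : 0 < a -> 0 < b ->
  is_Sec mu phi psi L -> is_Sec mu (h1scale a phi) (h1scale b psi) L.
Proof.
move=> a0 b0 h; apply: eq_is_limstar (is_limstar_rescale a0 b0 h) => s t.
rewrite !h1scaleM Lambda_scale//.
by congr (3 / _ * _); ring.
Qed.

Lemma is_Sec_scale_iff mu (a b L : R) phi psi : 0 < a -> 0 < b ->
  is_Sec mu (h1scale a phi) (h1scale b psi) L <-> is_Sec mu phi psi L.
Proof.
move=> a0 b0; split; last exact: is_Sec_scale.
have ai0 : 0 < a^-1 by rewrite invr_gt0.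
have bi0 : 0 < b^-1 by rewrite invr_gt0.
have aV : a^-1 * a = 1 by rewrite mulVf ?gt_eqF.
have bV : b^-1 * b = 1 by rewrite mulVf ?gt_eqF.
move=> /(is_Sec_scale ai0 bi0); rewrite !h1scaleM aV bV !h1scale1.
exact: id.
Qed.

Lemma is_Sec_lift_twist mu phi psi (L1 L2 : R) :
  is_Sec_lift mu phi psi L1 -> is_Sec_twist mu phi psi L2 ->
  is_Sec mu phi psi (L1 + L2).
Proof.
move=> H1 H2; apply: eq_is_limstar (is_limstarD H1 H2) => s t.
by rewrite -mulrDr addrA subrK.
Qed.

Lemma is_Sec_twist_ge0 (mu : {finite_measure set (borelM M) -> \bar R})
    phi psi (L : R) : mu setT != 0%E -> in_H1 mu phi -> in_H1 mu psi ->
  0 < Lambda mu phi psi -> is_Sec_twist mu phi psi L -> 0 <= L.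
Proof.
move=> mu0 hphi hpsi Lam0; apply: is_limstar_ge0 => s t s0 t0.
have muT : (mu setT < +oo)%E.
  by rewrite fin_num_fun_lty//; exact: fin_num_measure.
pose r := PosNum (r_of_gt0 muT mu0).
apply: mulr_ge0; first by rewrite divr_ge0// !mulr_ge0 ?sqr_ge0// ltW.
rewrite subr_ge0.
by apply: (@sqr_HK_le_lifted_cost _ _ _ mu r) => //;
  exact: (@exp_field_radius_finite _ _ _ mu r).
Qed.

Section mscale.
Variables (mu : {measure set (borelM M) -> \bar R}) (a : {nonneg R}).
Hypotheses (a0 : 0 < a%:num) (muT : (mu setT < +oo)%E) (mu0 : mu setT != 0%E).

Let k : {posnum R} := PosNum (etrans (sqrtr_gt0 _) a0).

Let ka : k%:num ^+ 2 = a%:num.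
Proof. by rewrite sqr_sqrtr. Qed.

Let r : {posnum R} := PosNum (r_of_gt0 muT mu0).

Let mu_measure : exists m : {measure set (borelC M) -> \bar R}, m = hat mu :> (_ -> _).
Proof. exact: (@hat_is_measure _ _ _ mu r). Qed.

Let amu_measure : exists m : {measure set (borelC M) -> \bar R},
  m = hat (mscale a mu) :> (_ -> _).
Proof.
apply: (@hat_is_measure _ _ _ _ (k%:num * r%:num)%:pos).
by rewrite (r_of_mscale mu ka).
Qed.

Lemma sqr_HK_mscale phi psi :
  HK (exp_mu (mscale a mu) phi) (exp_mu (mscale a mu) psi) ^+ 2 =
  a%:num * HK (exp_mu mu phi) (exp_mu mu psi) ^+ 2.
Proof.
have [[m mE] [m' m'E]] := (mu_measure, amu_measure).
rewrite -ka; apply: sqr_HK_dil => A; exact: (exp_mu_dil (hat_mscale mu ka) mE m'E).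
Qed.

Lemma lifted_cost_mscale phi psi :
  lifted_cost (mscale a mu) phi psi = a%:num * lifted_cost mu phi psi.
Proof.
have [[m mE] [m' m'E]] := (mu_measure, amu_measure).
by rewrite -ka (lifted_cost_dil (hat_mscale mu ka) mE m'E).
Qed.

Lemma sqr_h1norm_mscale phi :
  h1norm (mscale a mu) phi ^+ 2 = a%:num * h1norm mu phi ^+ 2.
Proof. by rewrite !sqr_h1norm h1inner_mscale. Qed.

(** The three quotients are differences of two terms that each acquire the factor a, so one
    statement with arbitrary F and G serves them all. *)
Let limstar_mscale (F G : R -> R -> R) (phi psi : h1pair M) (L : R) :
  is_limstar (fun s t => 3 / (Lambda (mscale a mu) phi psi * s ^+ 2 * t ^+ 2) *
    (a%:num * F s t - a%:num * G s t)) (a%:num^-1 * L) <->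
  is_limstar (fun s t => 3 / (Lambda mu phi psi * s ^+ 2 * t ^+ 2) *
    (F s t - G s t)) L.
Proof.
have a1 : a%:num^-1 != 0 by rewrite invr_eq0 gt_eqF.
apply: iff_trans (is_limstarZ_iff _ L a1).
have E (s t : R) : 3 / (Lambda (mscale a mu) phi psi * s ^+ 2 * t ^+ 2) *
    (a%:num * F s t - a%:num * G s t) =
  a%:num^-1 * (3 / (Lambda mu phi psi * s ^+ 2 * t ^+ 2) * (F s t - G s t)).
  rewrite Lambda_mscale// -mulrBr; set l := Lambda mu phi psi.
  (* The inverse is kept as an atom, so that [field] asks only for a != 0: Lambda, s and t may
     vanish here. *)
  rewrite -!(mulrA (a%:num ^+ 2)) invfM; set c := (l * _ * _)^-1.
  by field; rewrite gt_eqF.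
by split; apply: eq_is_limstar => s t; rewrite E.
Qed.

Lemma is_Sec_mscale phi psi (L : R) :
  is_Sec (mscale a mu) phi psi (a%:num^-1 * L) <-> is_Sec mu phi psi L.
Proof.
apply: iff_trans (limstar_mscale _ _ phi psi L).
split; apply: eq_is_limstar => s t; congr (_ * (_ - _)).
- exact: sqr_h1norm_mscale.
- exact: sqr_HK_mscale.
- exact/esym/sqr_h1norm_mscale.
- exact/esym/sqr_HK_mscale.
Qed.

Lemma is_Sec_lift_mscale phi psi (L : R) :
  is_Sec_lift (mscale a mu) phi psi (a%:num^-1 * L) <-> is_Sec_lift mu phi psi L.
Proof.
apply: iff_trans (limstar_mscale _ _ phi psi L).
split; apply: eq_is_limstar => s t; congr (_ * (_ - _)).
- exact: sqr_h1norm_mscale.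
- exact: lifted_cost_mscale.
- exact/esym/sqr_h1norm_mscale.
- exact/esym/lifted_cost_mscale.
Qed.

Lemma is_Sec_twist_mscale phi psi (L : R) :
  is_Sec_twist (mscale a mu) phi psi (a%:num^-1 * L) <-> is_Sec_twist mu phi psi L.
Proof.
apply: iff_trans (limstar_mscale _ _ phi psi L).
split; apply: eq_is_limstar => s t; congr (_ * (_ - _)).
- exact: lifted_cost_mscale.
- exact: sqr_HK_mscale.
- exact/esym/lifted_cost_mscale.
- exact/esym/sqr_HK_mscale.
Qed.

End mscale.

End sectional_curvature.

Unset Implicit Arguments.
Set Strict Implicit.
Set Printing Implicit Defensive.

Theorem theorem5p2 (R : realType) (n : nat) (M : riemannian_manifold R n)
  (hM : bounded_sectional_curvature M)
  (mu : {finite_measure set (borelM M) -> \bar R})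
  (mu_neq0 : mu setT != 0%E)
  (phi psi : h1pair M) (hphi : in_H1 mu phi) (hpsi : in_H1 mu psi)
  (hLambda : 0 < Lambda mu phi psi)
  (hadm : exists2 e : R, 0 < e & forall s : R, 0 < s < e ->
    admissible mu (h1scale s phi) /\ admissible mu (h1scale s psi)) :
  [/\ (forall L1 L2 : R, is_Sec_lift mu phi psi L1 ->
         is_Sec_twist mu phi psi L2 -> is_Sec mu phi psi (L1 + L2)),
      (forall L : R, is_Sec_twist mu phi psi L -> 0 <= L),
      (forall a b L : R, 0 < a -> 0 < b ->
         is_Sec mu (h1scale a phi) (h1scale b psi) L <-> is_Sec mu phi psi L) &
      (forall (a : R) (ha : 0 < a) (L : R),
         let amu := mscale (NngNum (ltW ha)) mu in
         [/\ is_Sec amu phi psi (a^-1 * L) <-> is_Sec mu phi psi L,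
             is_Sec_lift amu phi psi (a^-1 * L) <-> is_Sec_lift mu phi psi L &
             is_Sec_twist amu phi psi (a^-1 * L)
               <-> is_Sec_twist mu phi psi L])].
Proof.
have muT : (mu setT < +oo)%E.
  by rewrite fin_num_fun_lty//; exact: fin_num_measure.
split.
- by move=> L1 L2; exact: is_Sec_lift_twist.
- by move=> L; exact: is_Sec_twist_ge0.
- by move=> a b L a0 b0; exact: is_Sec_scale_iff.
move=> a a0 L /=.
by split; [exact: (@is_Sec_mscale _ _ _ mu (NngNum (ltW a0)) a0 muT mu_neq0)
  |exact: (@is_Sec_lift_mscale _ _ _ mu (NngNum (ltW a0)) a0 muT mu_neq0)
  |exact: (@is_Sec_twist_mscale _ _ _ mu (NngNum (ltW a0)) a0 muT mu_neq0)].
Qed.
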